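(* Let $\{\rho_n\}$ be a sequence in $[-1,1]$, put $\lambda_n=\left(\tfrac12 b_n^2(1-\rho_n)\right)^{1/2}$, and suppose that for some $\lambda\in(0,\infty)$ and some $\alpha\in\mathbb{R}$ $$\lim_{n\to\infty} b_n^2(\lambda-\lambda_n)=\alpha .$$ Then for all $x,y\in\mathbb{R}$ $$\lim_{n\to\infty} b_n^2\Big(F_{\rho_n}^n(u_n(x),u_n(y))-H_\lambda(x,y)\Big)=\kappa(\alpha,\lambda,x,y)\,H_\lambda(x,y),$$ where $$\kappa(\alpha,\lambda,x,y)=s(x)\Phi\left(\lambda+\frac{y-x}{2\lambda}\right)+s(y)\Phi\left(\lambda+\frac{x-y}{2\lambda}\right)+\big(2\alpha-\lambda(\lambda^2+x+y+2)\big)e^{-x}\varphi\left(\lambda+\frac{y-x}{2\lambda}\right).$$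
   Context: $\Phi$ is the standard normal $N(0,1)$ distribution function and $\varphi=\Phi'$ its density. The constant $b_n$ is defined by $n(1-\Phi(b_n))=1$, and $u_n(z)=b_n+z/b_n$ for $z\in\mathbb{R}$ (for $n\ge 3$, so that $b_n>0$). For $\rho\in[-1,1]$, $F_\rho$ is the joint distribution function of a bivariate Gaussian vector with zero means, unit variances and correlation $\rho$; $F_\rho^n$ is its $n$-th power. For $\lambda\in(0,\infty)$ the H\''usler--Reiss distribution is $$H_{\lambda}(x,y)=\exp\left(-\Phi\left(\lambda+\frac{y-x}{2\lambda}\right)e^{-x}-\Phi\left(\lambda+\frac{x-y}{2\lambda}\right)e^{-y}\right),\quad x,y\in\mathbb{R}.$$ The function $s$ is $s(z)=\tfrac12(z^2+2z)e^{-z}$, $z\in\mathbb{R}$. *)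

(* Defs.v *)
From mathcomp Require Import all_boot all_order all_algebra.
From mathcomp Require Import all_classical all_reals all_analysis.

Set Implicit Arguments.
Unset Strict Implicit.
Unset Printing Implicit Defensive.

Import Order.TTheory GRing.Theory Num.Theory.
Import numFieldNormedType.Exports.

Local Open Scope classical_set_scope.
Local Open Scope ring_scope.

Definition Phi {R : realType} (x : R) : R :=
  fine (normal_prob (0 : R) (1 : R) `]-oo, x]).

Definition phi {R : realType} (x : R) : R := normal_pdf 0 1 x.

(* The law of the Gaussian vector A Z, where Z is a pair of independent
   standard normal variables and A is the Cholesky factor
     1     0
     rho   sqrt (1 - rho^2)
   of the covariance matrix with unit variances and correlation rho; for
   rho = 1 or rho = -1 it is degenerate, carried by a line. *)
Definition gauss2 {R : realType} (rho : R) : set (R * R) -> \bar R :=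
  pushforward (normal_prob (0 : R) (1 : R) \x normal_prob (0 : R) (1 : R))%E
    (fun z : R * R => (z.1, rho * z.1 + Num.sqrt (1 - rho ^+ 2) * z.2)).

Definition gauss2_cdf {R : realType} (rho x y : R) : R :=
  fine (gauss2 rho (`]-oo, x] `*` `]-oo, y])).

Definition husler_reiss {R : realType} (lambda x y : R) : R :=
  expR (- Phi (lambda + (y - x) / (2 * lambda)) * expR (- x)
        - Phi (lambda + (x - y) / (2 * lambda)) * expR (- y)).

(* The level u_n(z), as a function of the value bn of b_n. *)
Definition norming {R : realType} (bn z : R) : R := bn + z / bn.

(* lambda_n, as a function of the values of b_n and rho_n. *)
Definition hr_lambda {R : realType} (bn rhon : R) : R :=
  Num.sqrt (2^-1 * bn ^+ 2 * (1 - rhon)).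

Definition s {R : realType} (z : R) : R := 2^-1 * (z ^+ 2 + 2 * z) * expR (- z).

Definition kappa {R : realType} (alpha lambda x y : R) : R :=
  s x * Phi (lambda + (y - x) / (2 * lambda))
  + s y * Phi (lambda + (x - y) / (2 * lambda))
  + (2 * alpha - lambda * (lambda ^+ 2 + x + y + 2)) * expR (- x)
    * phi (lambda + (y - x) / (2 * lambda)).

(* Main.v *)
(* Write u(z) = b_n + z / b_n and consider T_n(x) = n (1 - F_rho(u(x), u(y))).
   Its derivative in x is explicit: it is - c_n Phi(A_n(x)) exp(- x - x^2 / (2 b_n^2)),
   where c_n = n phi(b_n) / b_n satisfies b_n^2 (c_n - 1) --> 1 by Mills' ratio, and
   A_n is affine, with coefficients known up to o(b_n^-2) by the assumption on
   lambda_n. This yields a first-order expansion of the derivative in powers of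
   b_n^-2, uniform in x up to a polynomial weight. It can be integrated from x to
   infinity without computing any integral, because the exponent of H_lambda and
   kappa, as functions of x, are primitives of the two terms of the expansion. At
   infinity there remains the margin n (1 - Phi(u(y))), treated in the same way.
   Finally F^n = (1 - T_n / n)^n is exp(- T_n) up to O(1 / n) = o(b_n^-2). *)

(* The expansion of the derivative must hold up to infinity, where its coefficients grow
   polynomially. Errors are therefore measured against powers of [1 + z ^+ 2], and the factor
   [expR (- z)] pays for them. The third power suffices: none for c_n, one for the affine argument
   inside [Phi], two for the Gaussian factor. Integrals occur only in the study of the normal laws;
   later on, inequalities between derivatives replace them. That the exponent and [kappa] are
   primitives rests on the identity [phi_hr_arg_swap], which merges the density terms coming from
   the two [Phi]. It also explains why [kappa], although symmetric in x and y, displays a single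
   [phi] term. Differentiating in x breaks the symmetry of the coordinates. The limit at infinity
   involves the law of the second one, which the Cholesky construction does not give directly: the
   joint density has to be disintegrated the other way round. *)
Require Import Defs.
From mathcomp Require Import all_boot all_order all_algebra.
From mathcomp Require Import all_classical all_reals all_analysis.
From mathcomp Require Import measurable_realfun ring lra.

Set Implicit Arguments.
Unset Strict Implicit.
Unset Printing Implicit Defensive.

Import Order.TTheory GRing.Theory Num.Theory.
Import numFieldNormedType.Exports.

Local Open Scope classical_set_scope.
Local Open Scope ring_scope.

(** * Derivatives *)

(* [is_derive] is a type class, whose automatic resolution yields derivatives
   in a form that [ring] does not handle; [has_derive] is opaque to it. *)
Definition has_derive (R : realType) (f : R -> R) (x a : R) : Prop :=
  is_derive x (1 : R) f a.

Section has_derive.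
Context {R : realType}.
Implicit Types (f g : R -> R) (a b c x : R).

Lemma has_derive_eq f x a b : has_derive f x a -> a = b -> has_derive f x b.
Proof. by move=> fa <-. Qed.

Lemma has_derive_cst c x : has_derive (fun=> c) x 0.
Proof. exact: is_derive_cst. Qed.

Lemma has_derive_id x : has_derive (fun t : R => t) x 1.
Proof. exact: is_derive_id. Qed.

Lemma has_deriveD f g x a b : has_derive f x a -> has_derive g x b ->
  has_derive (fun t => f t + g t) x (a + b).
Proof. exact: is_deriveD. Qed.

Lemma has_deriveN f x a : has_derive f x a -> has_derive (fun t => - f t) x (- a).
Proof. exact: is_deriveN. Qed.

Lemma has_deriveM f g x a b : has_derive f x a -> has_derive g x b ->
  has_derive (fun t => f t * g t) x (f x * b + g x * a).
Proof. exact: is_deriveM. Qed.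

Lemma has_derive_sqr f x a : has_derive f x a ->
  has_derive (fun t => f t ^+ 2) x (2 * f x * a).
Proof.
move=> fa; under eq_fun do rewrite expr2.
have -> : 2 * f x * a = f x * a + f x * a by ring.
exact: has_deriveM.
Qed.

Lemma has_deriveV f x a : f x != 0 -> has_derive f x a ->
  has_derive (fun t => (f t)^-1) x (- a / f x ^+ 2).
Proof.
move=> fx fa; apply: has_derive_eq; first exact: (@is_deriveV R f x a 1 fx fa).
by rewrite /GRing.scale/=; field.
Qed.

Lemma has_derive_inv x : x != 0 -> has_derive GRing.inv x (- 1 / x ^+ 2).
Proof. by move=> x0; exact: (has_deriveV x0 (has_derive_id x)). Qed.

Lemma has_derive_comp f g x a b : has_derive f (g x) a -> has_derive g x b ->
  has_derive (fun t => f (g t)) x (a * b).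
Proof. exact: is_derive1_comp. Qed.

Lemma has_derive_expR f x a : has_derive f x a ->
  has_derive (fun t => expR (f t)) x (expR (f x) * a).
Proof. by move=> fa; apply: has_derive_comp => //; exact: is_derive_expR. Qed.

Lemma has_derive_derivable f x a : has_derive f x a -> derivable f x 1.
Proof. by move=> /@ex_derive. Qed.

Lemma has_derive_derive1 f x a : has_derive f x a -> derive1 f x = a.
Proof. by rewrite derive1E => /@derive_val. Qed.

Lemma has_derive_continuous f x a : has_derive f x a -> {for x, continuous f}.
Proof.
move=> /has_derive_derivable f'x; apply: differentiable_continuous.
exact/derivable1_diffP.
Qed.

(** The mean value theorem for [g - f]. This comparison replaces the integration of inequalities,
    both for Mills' ratio and for the tails of expansions. *)
Lemma has_derive_le f g f' g' a b : a <= b ->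
  (forall t, a <= t <= b -> has_derive f t (f' t)) ->
  (forall t, a <= t <= b -> has_derive g t (g' t)) ->
  (forall t, a <= t <= b -> f' t <= g' t) -> f b - f a <= g b - g a.
Proof.
move=> ab df dg fg.
have dh t : a <= t <= b -> has_derive (fun t => g t - f t) t (g' t - f' t).
  by move=> tab; apply: has_deriveD; [exact: dg|apply: has_deriveN; exact: df].
have [c||c ct] := @MVT_segment R (fun t => g t - f t) (fun t => g' t - f' t) a b ab.
- by rewrite in_itv/= => /andP[ac cb]; apply: dh; rewrite !ltW.
- apply: continuous_in_subspaceT => t; rewrite inE/= in_itv/= => tab.
  exact: has_derive_continuous (dh _ tab).
rewrite in_itv/= in ct; move=> gfE.
have : 0 <= (g' c - f' c) * (b - a) by rewrite mulr_ge0 ?subr_ge0// fg.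
by rewrite -gfE; lra.
Qed.

(** Recording only the distance from [c] to [s] leaves the order of [s] and [t] open and allows a
    second application between [s] and [c]. *)
Lemma has_derive_MVT f f' (s t : R) : (forall x, has_derive f x (f' x)) ->
  exists2 c, `|c - s| <= `|t - s| & f t - f s = f' c * (t - s).
Proof.
move=> df; have cf : continuous f by move=> x; exact: has_derive_continuous (df x).
have seg u v : u <= v -> exists2 c, u <= c <= v & f v - f u = f' c * (v - u).
  move=> uv; have [x _||c] := @MVT_segment R f f' u v uv.
  - exact: df.
  - exact: continuous_subspaceT.
  - by rewrite in_itv/=; exists c.
case: (leP s t) => [st|/ltW ts].
  have [c /andP[sc ct] E] := seg _ _ st; exists c => //.
  by rewrite !ger0_norm ?subr_ge0//; lra.
have [c /andP[tc cs] E] := seg _ _ ts; exists c; last by lra.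
by rewrite !ler0_norm ?subr_le0//; lra.
Qed.

End has_derive.

(** * Normal distributions *)

(** The density and the Radon-Nikodym derivative have the same integral over every measurable set,
    hence agree almost everywhere. *)
Lemma ge0_integral_normal_prob (R : realType) (m sigma : R) (E : set R)
    (f : R -> \bar R) :
  measurable E -> measurable_fun E f -> (forall x, (0 <= f x)%E) ->
  (\int[normal_prob m sigma]_(x in E) f x =
   \int[lebesgue_measure]_(x in E) (f x * (normal_pdf m sigma x)%:E))%E.
Proof.
move=> mE mf f0.
have nd := normal_prob_dominates m sigma.
rewrite -(@Radon_Nikodym_SigmaFinite.change_of_variables _ _ _
  (normal_prob m sigma) lebesgue_measure)//.
have mpdf : measurable_fun [set: R] (fun x => (normal_pdf m sigma x)%:E).
  by apply/measurable_EFinP; exact: measurable_normal_pdf.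
have irn : lebesgue_measure.-integrable [set: R]
    (Radon_Nikodym_SigmaFinite.f (normal_prob m sigma) lebesgue_measure).
  exact: Radon_Nikodym_SigmaFinite.f_integrable.
apply: ae_eq_integral => //.
- by apply: emeasurable_funM => //; apply: measurable_funTS; exact: measurable_int irn.
- by apply: emeasurable_funM => //; exact: measurable_funTS.
- apply: ae_eqe_mul2l; apply: integral_ae_eq => //=.
  + exact: integrableS irn.
  + exact: measurable_funTS.
  + move=> A AE mA.
    by rewrite -Radon_Nikodym_SigmaFinite.f_integral//; exact: normal_prob_dominates.
Qed.

Section standard_normal.
Context {R : realType}.
Implicit Types s t x y : R.

Lemma phiE x : phi x = (Num.sqrt (pi *+ 2))^-1 * expR (- x ^+ 2 / 2).
Proof.
rewrite /phi normal_pdfE ?oner_neq0// /normal_peak /normal_fun subr0.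
by rewrite expr1n mul1r.
Qed.

Lemma phi_gt0 x : 0 < phi x.
Proof. by rewrite phiE mulr_gt0 ?expR_gt0// invr_gt0 sqrtr_gt0 mulrn_wgt0// pi_gt0. Qed.

Lemma continuous_phi : continuous (@phi R).
Proof. by apply: continuous_normal_pdf; exact: oner_neq0. Qed.

Lemma EFin_Phi x : (Phi x)%:E = normal_prob 0 1 `]-oo, x].
Proof. by rewrite /Phi fineK// fin_num_measure. Qed.

Lemma Phi_ge0 x : 0 <= Phi x.
Proof. by rewrite -lee_fin EFin_Phi. Qed.

Lemma Phi_le1 x : Phi x <= 1.
Proof. by rewrite -lee_fin EFin_Phi; exact: probability_le1. Qed.

Lemma has_derive_Phi x : has_derive (@Phi R) x (phi x).
Proof.
(* The bound [x + 1] places [x] in the interior of the domain of integration. *)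
have intphi : lebesgue_measure.-integrable `]-oo, x + 1] (EFin \o @phi R).
  by apply: (integrableS measurableT) => //; exact: integrable_normal_pdf.
have [d1 d2] := continuous_FTC1 (ltr_pwDr ltr01 (lexx x)) intphi (ltNyr x)
  (@continuous_phi x).
by apply: DeriveDef; rewrite -?derive1E.
Qed.

Lemma Phi_lt x y : x < y -> Phi x < Phi y.
Proof.
move=> xy; have [z _||c _] := @MVT R Phi phi x y xy.
- exact: has_derive_Phi.
- by apply: continuous_subspaceT => z; exact: has_derive_continuous (has_derive_Phi z).
by move=> /eqP; rewrite subr_eq => /eqP ->; rewrite ltrDr mulr_gt0 ?phi_gt0// subr_gt0.
Qed.

Lemma Phi_le x y : x <= y -> Phi x <= Phi y.
Proof. by rewrite le_eqVlt => /orP[/eqP -> //|/Phi_lt/ltW]. Qed.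

Lemma cvg_Phi : Phi x @[x --> +oo] --> (1 : R).
Proof.
(* Along the integers this is continuity of the measure from below; monotonicity of [Phi] does the
   rest. *)
have Phi_n : Phi n%:R @[n --> \oo] --> (1 : R).
  apply: fine_cvg; rewrite -(@probability_setT _ (measurableTypeR R) R (normal_prob 0 1)).
  have <- : \bigcup_n `]-oo, n%:R]%classic = [set: R].
    rewrite -subTset => t _/=.
    by exists (Num.truncn t).+1; rewrite //= in_itv/= ltW// truncnS_gt.
  apply: nondecreasing_cvg_mu => //; first exact: bigcup_measurable.
  move=> n m nm; apply/subsetPset => x/=; rewrite !in_itv/= => /le_trans.
  by apply; rewrite ler_nat.
apply/cvgrPdist_lt => e e0.
have /cvgrPdist_lt/(_ e e0) [N _ /(_ N (leqnn N)) /= HN] := Phi_n.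
near=> x.
rewrite ger0_norm ?subr_ge0 ?Phi_le1// in HN *.
rewrite ger0_norm ?subr_ge0 ?Phi_le1//; apply: le_lt_trans HN.
by rewrite lerD2l lerN2 Phi_le//; near: x; apply: nbhs_pinfty_ge; rewrite num_real.
Unshelve. all: by end_near. Qed.

Lemma Phi_lt1 x : Phi x < 1.
Proof. by apply: lt_le_trans (Phi_le1 (x + 1)); rewrite Phi_lt// ltrDl. Qed.

Lemma phi_le_expR x : phi x <= expR (- x ^+ 2 / 2).
Proof.
rewrite phiE ler_piMl ?expR_ge0//.
have s1 : 1 <= Num.sqrt (pi *+ 2 : R).
  have pi2 := @pi_ge2 R.
  by rewrite -{1}(sqrtr1 R) ler_sqrt -mulr_natr; lra.
by rewrite invr_le1 ?unitfE ?gt_eqF //; lra.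
Qed.

(** From 1 + w <= exp w at w = x^2 / 2. It serves to bound the derivative of [phi] by 1 and x^2
    phi(x) by 2. *)
Lemma phi_le x : phi x * (1 + x ^+ 2 / 2) <= 1.
Proof.
have x2 : 0 < 1 + x ^+ 2 / 2 by have := sqr_ge0 x; lra.
rewrite -ler_pdivlMr// div1r (le_trans (phi_le_expR x))//.
rewrite mulNr expRN lef_pV2 ?posrE ?expR_gt0//; exact: expR_ge1Dx.
Qed.

Lemma phi_le1 x : phi x <= 1.
Proof. by have := phi_le x; have := sqr_ge0 x; have := phi_gt0 x; nra. Qed.

Lemma has_derive_phi x : has_derive (@phi R) x (- x * phi x).
Proof.
rewrite (funext phiE).
apply: has_derive_eq.
  apply: has_deriveM; first exact: has_derive_cst.
  apply: has_derive_expR; apply: has_deriveM; last exact: has_derive_cst.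
  by apply: has_deriveN; apply: has_derive_sqr; exact: has_derive_id.
by cbv beta; field; rewrite gt_eqF// sqrtr_gt0 mulrn_wgt0// pi_gt0.
Qed.

(** Two mean value steps, the derivative of [phi] being at most 1 in absolute value. The constant is
    the same on the whole line, which makes [expansion_Phi] uniform. *)
Lemma Phi_taylor1 s t : `|Phi t - Phi s - phi s * (t - s)| <= (t - s) ^+ 2.
Proof.
have [c cs ->] := has_derive_MVT s t has_derive_Phi.
have [d ds E] := has_derive_MVT s c has_derive_phi.
have d1 : `|- d * phi d| <= 1.
  have := phi_le d; have := phi_gt0 d; have := sqr_ge0 (`|d| - 1).
  have := real_normK (num_real d); rewrite normrM normrN (gtr0_norm (phi_gt0 d)).
  nra.
rewrite -mulrBl E -(real_normK (num_real (t - s))) expr2 normrM ler_wpM2r//.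
by rewrite normrM -[leRHS]mul1r ler_pM.
Qed.

Lemma has_derive_Phi_comp (f : R -> R) x a : has_derive f x a ->
  has_derive (fun t => Phi (f t)) x (phi (f x) * a).
Proof. by move=> fa; apply: has_derive_comp => //; exact: has_derive_Phi. Qed.

Lemma has_derive_phi_comp (f : R -> R) x a : has_derive f x a ->
  has_derive (fun t => phi (f t)) x (- f x * phi (f x) * a).
Proof. by move=> fa; apply: has_derive_comp => //; exact: has_derive_phi. Qed.

End standard_normal.

(** Goes by the syntax of the function and leaves the nonvanishing of denominators as goals. The
    cases without a binder, such as [-%R] or [GRing.inv], meet eta-contracted functions. *)
Ltac solve_derive := lazymatch goal with
  | |- has_derive (fun=> ?c) _ _ => exact: has_derive_cst
  | |- has_derive (fun t => t) _ _ => exact: has_derive_id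
  | |- has_derive (fun t => expR _) _ _ => apply: has_derive_expR; solve_derive
  | |- has_derive (fun t => Phi _) _ _ => apply: has_derive_Phi_comp; solve_derive
  | |- has_derive (fun t => phi _) _ _ => apply: has_derive_phi_comp; solve_derive
  | |- has_derive (fun t => _ ^+ 2) _ _ => apply: has_derive_sqr; solve_derive
  | |- has_derive (fun t => _ + _) _ _ => apply: has_deriveD; solve_derive
  | |- has_derive (fun t => - _) _ _ => apply: has_deriveN; solve_derive
  | |- has_derive (fun t => _ * _) _ _ => apply: has_deriveM; solve_derive
  | |- has_derive (fun t => _^-1) _ _ => apply: has_deriveV; [|solve_derive]
  | |- has_derive -%R _ _ => apply: has_deriveN; exact: has_derive_id
  | |- has_derive ( *%R _) _ _ => apply: has_deriveM; [exact: has_derive_cst|exact: has_derive_id]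
  | |- has_derive (+%R _) _ _ => apply: has_deriveD; [exact: has_derive_cst|exact: has_derive_id]
  | |- has_derive GRing.inv _ _ => apply: has_derive_inv
  | |- has_derive Phi _ _ => exact: has_derive_Phi
  | |- has_derive phi _ _ => exact: has_derive_phi
  | |- _ => try eassumption
  end.

(** * The bivariate normal distribution function *)

Section bivariate_normal.
Context {R : realType}.
Implicit Types (m sigma rho x y u v w : R) (A : set R).
Notation mu := (@lebesgue_measure R).

Lemma normal_pdf_phi m sigma x : 0 < sigma ->
  normal_pdf m sigma x = phi ((x - m) / sigma) / sigma.
Proof.
move=> s0; have sn0 : sigma != 0 by rewrite gt_eqF.
rewrite phiE normal_pdfE// /normal_peak /normal_fun -mulrnAr.
rewrite sqrtrM ?sqr_ge0// sqrtr_sqr gtr0_norm// invfM mulrAC -mulrA mulrC.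
rewrite [expR _ / _]mulrC; congr (_ * expR _ / _).
by rewrite -mulr_natr; field.
Qed.

Lemma normal_prob_Phi m sigma v : 0 < sigma ->
  normal_prob m sigma `]-oo, v] = (Phi ((v - m) / sigma))%:E.
Proof.
move=> s0; rewrite EFin_Phi /normal_prob.
pose F x := (x - m) / sigma.
have dF x : has_derive F x sigma^-1.
  apply: has_derive_eq; first by rewrite /F; solve_derive.
  by cbv beta; ring.
have F'E : derive1 F = cst sigma^-1.
  apply/funext => x; exact: has_derive_derive1.
have cF : continuous F by move=> x; exact: has_derive_continuous (dF x).
rewrite (@increasing_ge0_integration_by_substitutionNy _ F phi v)//.
- by apply: eq_integral => x _; rewrite F'E /= normal_pdf_phi.
- by move=> x y _ _ xy; rewrite /F ltr_pM2r ?invr_gt0// ltrD2r.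
- by rewrite F'E => x _; exact: cst_continuous.
- by rewrite F'E; exact: is_cvg_cst.
- by rewrite F'E; exact: cvg_cst.
- split; first by move=> x _; exact: has_derive_derivable (dF x).
  by apply: cvg_at_left_filter; exact: cF.
- apply/gt0_cvgMlNy; last exact: cvg_addrr_Ny.
  by rewrite invr_gt0.
- by apply: continuous_subspaceT; exact: continuous_phi.
- by move=> x _; exact/ltW/phi_gt0.
Qed.

(** For |rho| < 1: given that the first coordinate is [x], the second is normal with mean rho x and
    variance 1 - rho^2. This is the conditional probability that it is at most [v], times the
    density of the first at [x]. *)
Definition gauss2_slice rho v x : R :=
  Phi ((v - rho * x) / Num.sqrt (1 - rho ^+ 2)) * phi x.

Lemma continuous_Phi_affine rho v sigma :
  continuous (fun x => Phi ((v - rho * x) / sigma)).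
Proof.
move=> x; apply: has_derive_continuous; apply: has_derive_comp.
  exact: has_derive_Phi.
by solve_derive.
Qed.

Lemma continuous_gauss2_slice rho v : continuous (gauss2_slice rho v).
Proof.
move=> x; apply: cvgM; last exact: continuous_phi.
exact: continuous_Phi_affine.
Qed.

Lemma gauss2_slice_ge0 rho v x : 0 <= gauss2_slice rho v x.
Proof. by rewrite mulr_ge0 ?Phi_ge0 ?ltW ?phi_gt0. Qed.

Lemma gauss2_slice_le rho v x : gauss2_slice rho v x <= phi x.
Proof. by rewrite ler_piMl ?Phi_le1// ltW// phi_gt0. Qed.

(** Both sides are the joint density, disintegrated along either coordinate. *)
Lemma phi_normal_pdf_swap rho x w : -1 < rho < 1 ->
  phi x * normal_pdf (rho * x) (Num.sqrt (1 - rho ^+ 2)) w =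
  phi w * normal_pdf (rho * w) (Num.sqrt (1 - rho ^+ 2)) x.
Proof.
move=> /andP[rho1 rho2].
have s0 : 0 < 1 - rho ^+ 2 by nra.
have ss0 : 0 < Num.sqrt (1 - rho ^+ 2) by rewrite sqrtr_gt0.
rewrite !normal_pdf_phi// !phiE !mulrA; congr (_ / _).
rewrite -!mulrA; congr (_ * _); rewrite ![expR _ * (_ * _)]mulrCA -!expRD.
congr (_ * expR _); rewrite !exprMn !exprVn sqr_sqrtr ?ltW//.
by field; rewrite gt_eqF.
Qed.

(** The product measure integrates the measures of sections, and for [x] in [A] the section is a
    half-line because the square root is positive. A general [A] covers both half-lines and the
    whole line, which yields the margin. *)
Lemma gauss2_prod rho A v : -1 < rho < 1 -> measurable A ->
  gauss2 rho (A `*` `]-oo, v]) =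
  (\int[mu]_(x in A) (gauss2_slice rho v x)%:E)%E.
Proof.
move=> /andP[rho1 rho2] mA.
have s0 : 0 < Num.sqrt (1 - rho ^+ 2) by rewrite sqrtr_gt0; nra.
pose g x := (Phi ((v - rho * x) / Num.sqrt (1 - rho ^+ 2)))%:E.
transitivity (\int[normal_prob 0 1]_(x in A) g x)%E; last first.
  rewrite ge0_integral_normal_prob//.
  - apply/measurable_EFinP; apply: measurable_funTS.
    by apply: continuous_measurable_fun; exact: continuous_Phi_affine.
  - by move=> x; rewrite lee_fin Phi_ge0.
rewrite integral_mkcond /gauss2 /pushforward /product_measure1.
apply: eq_integral => x _ /=; rewrite patchE.
case: ifPn => [|] xA.
  rewrite /g EFin_Phi; congr (normal_prob _ _ _).
  apply/seteqP; split => y /=; rewrite /xsection /= inE /= !in_itv/=.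
    by move=> [_]; rewrite ler_pdivlMr// lerBrDl [y * _]mulrC.
  by rewrite ler_pdivlMr// lerBrDl [y * _]mulrC => ->; split => //; exact: set_mem.
rewrite [X in normal_prob _ _ X](_ : _ = set0) ?measure0//.
rewrite -subset0 => y; rewrite /xsection /= inE /= => -[xA' _].
by move: xA; rewrite notin_setE; apply.
Qed.

(** Write the slice as an integral of the joint density, exchange the integrals by Tonelli, and use
    [phi_normal_pdf_swap]: the inner integral is then that of a normal density, namely 1. *)
Lemma gauss2_margin rho v : -1 < rho < 1 ->
  gauss2 rho ([set: R] `*` `]-oo, v]) = (Phi v)%:E.
Proof.
move=> rho11; rewrite gauss2_prod// EFin_Phi /normal_prob /gauss2_slice.
have /andP[rho1 rho2] := rho11.
set s := Num.sqrt _.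
have s0 : 0 < s by rewrite sqrtr_gt0; nra.
pose f (z : R * R) := (\1_`]-oo, v]%classic z.2 * (phi z.2 * normal_pdf (rho * z.2) s z.1))%:E.
have f0 z : (0 <= f z)%E.
  by rewrite lee_fin !mulr_ge0// ?normal_pdf_ge0// ltW// phi_gt0.
have mf : measurable_fun [set: R * R] f.
  apply/measurable_EFinP; apply: measurable_funM.
    by apply: measurableT_comp => //; exact: measurable_indic.
  apply: measurable_funM.
    by apply: measurableT_comp => //; exact: measurable_normal_pdf.
  under eq_fun do rewrite normal_pdf_phi//.
  apply: measurable_funM => //; apply: measurableT_comp => //.
    exact: measurable_normal_pdf.
  apply: measurable_funM => //; apply: measurable_funB => //.
  exact: measurable_funM.
transitivity (\int[mu]_x \int[mu]_y f (x, y))%E.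
  apply: eq_integral => x _.
  rewrite EFinM -normal_prob_Phi// muleC -ge0_integralZl//=.
  - rewrite integral_mkcond; apply: eq_integral => y _; rewrite patchE /f /=.
    rewrite indicE; case: ifPn => _; rewrite ?mul0r// mul1r -EFinM.
    by rewrite phi_normal_pdf_swap.
  - by apply/measurable_EFinP; apply: measurable_funTS; exact: measurable_normal_pdf.
  - by move=> y _; rewrite lee_fin normal_pdf_ge0.
  - by rewrite lee_fin ltW// phi_gt0.
rewrite fubini_tonelli// [RHS]integral_mkcond.
apply: eq_integral => y _; rewrite /f /= patchE indicE.
case: ifPn => _ /=; last by under eq_integral do rewrite mul0r; rewrite integral0.
under eq_integral do rewrite mul1r EFinM.
rewrite ge0_integralZl ?integral_normal_pdf ?mule1//.
- by apply/measurable_EFinP; exact: measurable_normal_pdf.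
- by move=> x _; rewrite lee_fin normal_pdf_ge0.
- by rewrite lee_fin ltW// phi_gt0.
Qed.

Lemma gauss2_cdf_Rintegral rho u v : -1 < rho < 1 ->
  gauss2_cdf rho u v =
  (\int[mu]_(x in `]-oo, u]) (gauss2_slice rho v x))%R.
Proof. by move=> rho1; rewrite /gauss2_cdf gauss2_prod//. Qed.

Lemma has_derive_gauss2_cdf rho u v : -1 < rho < 1 ->
  has_derive (fun t => gauss2_cdf rho t v) u
    (gauss2_slice rho v u).
Proof.
move=> rho1; under eq_fun do rewrite gauss2_cdf_Rintegral//.
have intf : mu.-integrable `]-oo, u + 1] (EFin \o gauss2_slice rho v).
  apply: (integrableS measurableT) => //.
  apply: (le_integrable _ _ _ (integrable_normal_pdf 0 1)) => //.
    by apply/measurable_EFinP; apply: continuous_measurable_fun; exact: continuous_gauss2_slice.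
  move=> x _; rewrite /= lee_fin !ger0_norm ?normal_pdf_ge0 ?gauss2_slice_ge0//.
  exact: gauss2_slice_le.
have [d1 d2] := continuous_FTC1 (ltr_pwDr ltr01 (lexx u)) intf (ltNyr u) (@continuous_gauss2_slice rho v u).
by apply: DeriveDef; rewrite -?derive1E.
Qed.

(** The defect is the integral of the slice over []u, +oo[], where the slice is at most [phi]. *)
Lemma gauss2_cdf_margin rho u v : -1 < rho < 1 ->
  `|gauss2_cdf rho u v - Phi v| <= 1 - Phi u.
Proof.
move=> rho1.
set f := gauss2_slice rho v.
have mf A : measurable_fun A (EFin \o f).
  by apply/measurable_EFinP; apply: measurable_funTS; apply: continuous_measurable_fun; exact: continuous_gauss2_slice.
have mphi A : measurable_fun A (EFin \o @phi R).
  by apply/measurable_EFinP; apply: measurable_funTS; exact: measurable_normal_pdf.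
have split g : measurable_fun [set: R] (EFin \o g) -> (forall x, 0 <= g x) ->
    (\int[mu]_x (g x)%:E = \int[mu]_(x in `]-oo, u]) (g x)%:E
                          + \int[mu]_(x in `]u, +oo[) (g x)%:E)%E.
  move=> mg g0; rewrite -ge0_integral_setU//=.
  - by rewrite -setCitvl setUv.
  - by apply: measurable_funTS.
  - by move=> x _; rewrite lee_fin.
  - by rewrite -setCitvl; apply/disj_setPCl.
have tail : (\int[mu]_(x in `]u, +oo[) (f x)%:E <= \int[mu]_(x in `]u, +oo[) (phi x)%:E)%E.
  apply: ge0_le_integral => //=.
  - by move=> x _; rewrite lee_fin gauss2_slice_ge0.
  - exact: mf.
  - exact: mphi.
  - by move=> x _; rewrite lee_fin gauss2_slice_le.
have tail0 : (0 <= \int[mu]_(x in `]u, +oo[) (f x)%:E)%E.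
  by apply: integral_ge0 => x _; rewrite lee_fin gauss2_slice_ge0.
have := split f (mf _) (gauss2_slice_ge0 rho v).
have := split phi (mphi _) (fun x => ltW (phi_gt0 x)).
have -> : (\int[mu]_(x in `]-oo, u]) (phi x)%:E = (Phi u)%:E)%E by rewrite EFin_Phi.
have -> : (\int[mu]_x (phi x)%:E = 1)%E by exact: integral_normal_pdf.
have := gauss2_margin v rho1; rewrite gauss2_prod// => -> tailphi tailf.
rewrite /gauss2_cdf gauss2_prod//; move: tail tail0 tailphi tailf.
move: (integral mu `]u, +oo[ (fun x => (phi x)%:E)) => J.
move: (integral mu `]u, +oo[ (fun x => (f x)%:E)) => I.
move: (integral mu `]-oo, u] (fun x => (f x)%:E)) => C.
(* The two sums have finite values, so only the case of three real integrals survives. *)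
case: J => [j||]; case: I => [i||]; case: C => [c||] //=.
rewrite !lee_fin => ij i0 [jE] [iE].
by rewrite iE opprD addNKr normrN ger0_norm//; lra.
Qed.

End bivariate_normal.

(** * Uniform first-order expansions *)

Section expansions.
Context {R : realType}.
Implicit Types (a : nat -> R).

Lemma expR_taylor1 (w : R) : 0 <= w -> 0 <= expR (- w) - 1 + w <= w ^+ 2.
Proof.
move=> w0; apply/andP; split; first by have := expR_ge1Dx (- w); lra.
rewrite expRN; have e1 := expR_ge1Dx w.
have : (expR w)^-1 <= (1 + w)^-1 by rewrite lef_pV2 ?posrE ?expR_gt0//; lra.
have : (1 + w)^-1 <= 1 - w + w ^+ 2.
  rewrite -[_^-1]mul1r ler_pdivrMr; last by lra.
  (* (1 - w + w^2) (1 + w) = 1 + w^3. *)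
  have : 0 <= w ^+ 3 by rewrite exprn_ge0.
  by nra.
lra.
Qed.

(** That is, f n = f0 + f1 / a n + o(1 / a n), with an error uniform on the line relative to a
    polynomial weight. The exponents [k] add up in products. *)
Definition expansion a (k : nat) (f : nat -> R -> R) (f0 f1 : R -> R) := forall e : R, 0 < e ->
  \forall n \near \oo, forall z,
    `|a n * (f n z - f0 z) - f1 z| <= e * (1 + z ^+ 2) ^+ k.

Let weight_ge1 (k : nat) (z : R) : 1 <= (1 + z ^+ 2) ^+ k.
Proof. by rewrite exprn_ege1// lerDl sqr_ge0. Qed.

Lemma expansion_cst a (c : nat -> R) (c0 c1 : R) :
  a n * (c n - c0) @[n --> \oo] --> c1 ->
  expansion a 0 (fun n _ => c n) (fun=> c0) (fun=> c1).
Proof.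
move=> /cvgrPdist_le ac e e0; near=> n => z; rewrite expr0 mulr1 distrC.
by near: n; exact: ac.
Unshelve. all: by end_near. Qed.

(** With [A] and [B] the errors of the factors, the error of the product is A g + f1 (g - g0) + f0
    B. The middle term is small because g - g0 is of order 1 / a n. *)
Lemma expansionM a (k l : nat) (f : nat -> R -> R) (f0 f1 : R -> R)
    (g : nat -> R -> R) (g0 g1 : R -> R) (C : R) :
  a n @[n --> \oo] --> +oo ->
  expansion a k f f0 f1 -> expansion a l g g0 g1 ->
  (forall z, `|f0 z| <= 1) -> (forall z, `|g0 z| <= 1) ->
  (forall z, `|f1 z| <= C * (1 + z ^+ 2) ^+ k) ->
  (forall z, `|g1 z| <= C * (1 + z ^+ 2) ^+ l) ->
  expansion a (k + l) (fun n z => f n z * g n z) (fun z => f0 z * g0 z)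
    (fun z => f1 z * g0 z + f0 z * g1 z).
Proof.
move=> ay exf exg f0_1 g0_1 f1C g1C e e0.
have C0 : 0 <= C by have := le_trans (normr_ge0 _) (f1C 0); rewrite expr0n/= addr0 expr1n mulr1.
have C3 : 0 < 2 * (C + 3) by lra.
(* Half of [e] covers the two terms with [A] and [B], which cost d (C + 2) and d; the other half
   covers the middle term, at most C (C + 1) / a n. *)
pose d := Num.min 1 (e / (2 * (C + 3))).
have d0 : 0 < d by rewrite lt_min ltr01 divr_gt0.
have d1 : d <= 1 by rewrite ge_min lexx.
have dC : d * (2 * (C + 3)) <= e by rewrite -ler_pdivlMr// ge_min lexx orbT.
near=> n => z.
have an1 : 1 <= a n by near: n; exact: (cvgry_ge ay).
have anC : 2 * C * (C + 1) <= e * a n.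
  rewrite -ler_pdivrMl//; near: n; exact: (cvgry_ge ay).
have : forall z, `|a n * (f n z - f0 z) - f1 z| <= d * (1 + z ^+ 2) ^+ k.
  by near: n; exact: exf.
have : forall z, `|a n * (g n z - g0 z) - g1 z| <= d * (1 + z ^+ 2) ^+ l.
  by near: n; exact: exg.
move=> /(_ z) gz /(_ z) fz.
have := weight_ge1 k z; have := weight_ge1 l z; move: (f1C z) (g1C z) (f0_1 z) (g0_1 z).
rewrite exprD.
move: gz fz.
set u := _ ^+ k; set v := _ ^+ l.
pose A := a n * (f n z - f0 z) - f1 z; pose B := a n * (g n z - g0 z) - g1 z.
rewrite -/A -/B.
move=> Bv Au f1u g1v f01 g01 v1 u1.
have a0 : 0 < a n by lra.
have gE : g n z - g0 z = (g1 z + B) / a n by rewrite /B; field; rewrite gt_eqF.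
have gd : `|g n z - g0 z| <= (C + 1) * v / a n.
  rewrite gE normrM normfV (gtr0_norm a0) ler_pM2r ?invr_gt0//.
  rewrite (le_trans (ler_normD _ _))// mulrDl mul1r lerD// (le_trans Bv)//.
  by rewrite ler_piMl//; lra.
have gb : `|g n z| <= (C + 2) * v.
  rewrite -(subrK (g0 z) (g n z)) (le_trans (ler_normD _ _))//.
  apply: (@le_trans _ _ ((C + 1) * v + v)); last by lra.
  apply: lerD; last by lra.
  rewrite (le_trans gd)// ler_pdivrMr// ler_peMr// mulr_ge0//; lra.
have -> : a n * (f n z * g n z - f0 z * g0 z) - (f1 z * g0 z + f0 z * g1 z) =
    A * g n z + f1 z * (g n z - g0 z) + f0 z * B.
  by rewrite /A /B; ring.
have t1 : `|A * g n z| <= d * u * ((C + 2) * v) by rewrite normrM ler_pM.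
have t2 : `|f1 z * (g n z - g0 z)| <= C * u * ((C + 1) * v / a n) by rewrite normrM ler_pM.
have t3 : `|f0 z * B| <= d * (u * v).
  rewrite normrM (le_trans (ler_pM _ _ f01 Bv))// mul1r ler_pM2l//.
  by rewrite ler_peMl//; lra.
have uv0 : 0 < u * v by rewrite mulr_gt0//; lra.
have t2' : C * u * ((C + 1) * v / a n) <= e / 2 * (u * v).
  rewrite (_ : C * u * ((C + 1) * v / a n) = (C * (C + 1) / a n) * (u * v)); last by field; rewrite gt_eqF.
  rewrite ler_pM2r// ler_pdivrMr//; lra.
have t4 : d * u * ((C + 2) * v) + d * (u * v) <= e / 2 * (u * v).
  rewrite (_ : _ + _ = (d * (C + 3)) * (u * v)); last by ring.
  by rewrite ler_pM2r//; lra.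
rewrite (le_trans (ler_normD _ _))//.
have := ler_normD (A * g n z) (f1 z * (g n z - g0 z)).
by lra.
Unshelve. all: by end_near. Qed.

(** The remainder of [expR_taylor1], multiplied by [a n], is at most z^4 / (4 a n), whence the
    exponent 2. *)
Lemma expansion_gauss a : a n @[n --> \oo] --> +oo ->
  expansion a 2 (fun n z => expR (- (z ^+ 2 / (2 * a n)))) (fun=> 1)
    (fun z => - (z ^+ 2 / 2)).
Proof.
move=> ay e e0; near=> n => z.
have a0 : 0 < a n by near: n; exact: (cvgry_gt ay).
have ae : 1 <= e * a n.
  by rewrite -ler_pdivrMl//; near: n; exact: (cvgry_ge ay).
have w0 : 0 <= z ^+ 2 / (2 * a n) by rewrite divr_ge0 ?sqr_ge0//; lra.
have /andP[] := expR_taylor1 w0.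
set E := expR _ => E0 E1.
have -> : a n * (E - 1) - - (z ^+ 2 / 2) = a n * (E - 1 + z ^+ 2 / (2 * a n)).
  by field; rewrite gt_eqF.
rewrite ger0_norm; last by rewrite mulr_ge0// ltW.
apply: (@le_trans _ _ (a n * (z ^+ 2 / (2 * a n)) ^+ 2)); first by rewrite ler_pM2l.
have -> : a n * (z ^+ 2 / (2 * a n)) ^+ 2 = (z ^+ 2) ^+ 2 / (4 * a n).
  by field; rewrite gt_eqF.
rewrite ler_pdivrMr; last by lra.
have z2 := sqr_ge0 z; set q := z ^+ 2 in z2 *.
have : 0 <= (e * a n - 1) * (1 + q) ^+ 2 by rewrite mulr_ge0 ?sqr_ge0//; lra.
nra.
Unshelve. all: by end_near. Qed.

Lemma expansion_Phi a (p q : nat -> R) (p0 q0 p1 q1 : R) :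
  a n @[n --> \oo] --> +oo ->
  a n * (p n - p0) @[n --> \oo] --> p1 -> a n * (q n - q0) @[n --> \oo] --> q1 ->
  expansion a 1 (fun n z => Phi (p n + q n * z)) (fun z => Phi (p0 + q0 * z))
    (fun z => phi (p0 + q0 * z) * (p1 + q1 * z)).
Proof.
move=> ay /cvgrPdist_le ap /cvgrPdist_le aq e e0.
pose C := `|p1| + `|q1| + 1.
have C0 : 0 < C by rewrite /C; have := normr_ge0 p1; have := normr_ge0 q1; lra.
pose d := Num.min 1 (e / 4).
have d0 : 0 < d by rewrite lt_min ltr01/=; lra.
have d1 : d <= 1 by rewrite ge_min lexx.
have de : d <= e / 4 by rewrite ge_min lexx orbT.
near=> n => z.
have a0 : 0 < a n by near: n; exact: (cvgry_gt ay).
(* Since (1 + |z|)^2 <= 2 (1 + z^2), this brings the quadratic remainder of [Phi_taylor1] below half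
   of the allowed error. *)
have ae : 4 * C ^+ 2 <= e * a n.
  by rewrite -ler_pdivrMl//; near: n; exact: (cvgry_ge ay).
have pd : `|p1 - a n * (p n - p0)| <= d by near: n; exact: ap.
have qd : `|q1 - a n * (q n - q0)| <= d by near: n; exact: aq.
rewrite expr1.
set s := p0 + q0 * z; set t := p n + q n * z.
have zz : `|z| <= (1 + z ^+ 2) / 2.
  by have := sqr_ge0 (`|z| - 1); have := real_normK (num_real z); nra.
have z0 := normr_ge0 z.
have ts : `|a n * (t - s) - (p1 + q1 * z)| <= d * (1 + `|z|).
  have -> : a n * (t - s) - (p1 + q1 * z) =
      - (p1 - a n * (p n - p0)) - (q1 - a n * (q n - q0)) * z by rewrite /t /s; ring.
  rewrite (le_trans (ler_normB _ _))// normrN normrM [leRHS]mulrDr mulr1.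
  by rewrite lerD// ler_wpM2r.
have ts' : `|a n * (t - s)| <= C * (1 + `|z|).
  rewrite -[X in `|X|](subrK (p1 + q1 * z)) (le_trans (ler_normD _ _))//.
  have := ler_normD p1 (q1 * z); rewrite normrM.
  have : d * (1 + `|z|) <= 1 * (1 + `|z|) by rewrite ler_pM2r//; lra.
  rewrite /C; have := normr_ge0 p1; have := normr_ge0 q1; nra.
have sq : a n * (t - s) ^+ 2 <= e / 2 * (1 + z ^+ 2).
  rewrite -(ler_pM2l a0) (_ : a n * (a n * _) = `|a n * (t - s)| ^+ 2); last first.
    by rewrite real_normK ?num_real//; ring.
  apply: (@le_trans _ _ ((C * (1 + `|z|)) ^+ 2)); first by rewrite ler_pXn2r ?nnegrE ?mulr_ge0//; lra.
  rewrite exprMn (_ : (1 + `|z|) ^+ 2 = 1 + 2 * `|z| + z ^+ 2); last first.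
    by rewrite -(real_normK (num_real z)); ring.
  have := sqr_ge0 C; have := sqr_ge0 z; nra.
have T := Phi_taylor1 s t.
have -> : a n * (Phi t - Phi s) - phi s * (p1 + q1 * z) =
   a n * (Phi t - Phi s - phi s * (t - s)) + phi s * (a n * (t - s) - (p1 + q1 * z)) by ring.
rewrite (le_trans (ler_normD _ _))//.
have : `|a n * (Phi t - Phi s - phi s * (t - s))| <= e / 2 * (1 + z ^+ 2).
  by rewrite normrM gtr0_norm// (le_trans _ sq)// ler_pM2l.
have : `|phi s * (a n * (t - s) - (p1 + q1 * z))| <= e / 2 * (1 + z ^+ 2).
  rewrite normrM gtr0_norm ?phi_gt0//.
  apply: (@le_trans _ _ (1 * (d * (1 + `|z|)))).
    by rewrite ler_pM ?phi_le1// ltW// phi_gt0.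
  rewrite mul1r; have := sqr_ge0 z; nra.
lra.
Unshelve. all: by end_near. Qed.

End expansions.

(** * Rates of convergence of sequences, and integration of an expansion up to infinity *)

Section rates.
Context {R : realType}.
Implicit Types (a : nat -> R).

Lemma cvg_to_eq (T : Type) (F : set_system T) (f : T -> R) (l l' : R) :
  f x @[x --> F] --> l -> l = l' -> f x @[x --> F] --> l'.
Proof. by move=> fl <-. Qed.

Lemma cvg_rate_inv a : a n @[n --> \oo] --> +oo -> (a n)^-1 @[n --> \oo] --> (0 : R).
Proof. by move=> ay; apply/gtr0_cvgV0 => //; exact: cvgry_gt. Qed.

Lemma rate_cvg a (f : nat -> R) (f0 f1 : R) : a n @[n --> \oo] --> +oo ->
  a n * (f n - f0) @[n --> \oo] --> f1 -> f n @[n --> \oo] --> f0.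
Proof.
move=> ay af.
have : f0 + a n * (f n - f0) * (a n)^-1 @[n --> \oo] --> f0.
  apply: cvg_to_eq.
    by apply: cvgD; [exact: cvg_cst|apply: cvgM; [exact: af|exact: cvg_rate_inv]].
  by rewrite mulr0 addr0.
apply: cvg_trans; apply: near_eq_cvg; near=> n.
have a0 : 0 < a n by near: n; exact: (cvgry_gt ay).
by field; rewrite gt_eqF.
Unshelve. all: by end_near. Qed.

(** The delta method: by Caratheodory's criterion g t - g f0 = h t (t - f0) with [h] continuous at
    [f0]. *)
Lemma rate_delta a (f : nat -> R) (f0 f1 g' : R) (g : R -> R) :
  a n @[n --> \oo] --> +oo -> a n * (f n - f0) @[n --> \oo] --> f1 ->
  has_derive g f0 g' -> a n * (g (f n) - g f0) @[n --> \oo] --> g' * f1.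
Proof.
move=> ay af /is_derive1_caratheodory[h [hE hc <-]].
have -> : (fun n => a n * (g (f n) - g f0)) = (fun n => h (f n) * (a n * (f n - f0))).
  by apply/funext => n; rewrite hE; ring.
apply: cvgM => //; apply: continuous_cvg => //; exact: rate_cvg af.
Qed.

Lemma rateM a (f g : nat -> R) (f0 f1 g0 g1 : R) :
  a n @[n --> \oo] --> +oo ->
  a n * (f n - f0) @[n --> \oo] --> f1 -> a n * (g n - g0) @[n --> \oo] --> g1 ->
  a n * (f n * g n - f0 * g0) @[n --> \oo] --> f1 * g0 + f0 * g1.
Proof.
move=> ay af ag.
have -> : (fun n => a n * (f n * g n - f0 * g0)) =
    (fun n => a n * (f n - f0) * g n + f0 * (a n * (g n - g0))).
  by apply/funext => n; ring.
apply: cvgD; first by apply: cvgM => //; exact: rate_cvg ag.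
by apply: cvgM => //; exact: cvg_cst.
Qed.

Lemma rateD a (f g : nat -> R) (f0 f1 g0 g1 : R) :
  a n * (f n - f0) @[n --> \oo] --> f1 -> a n * (g n - g0) @[n --> \oo] --> g1 ->
  a n * (f n + g n - (f0 + g0)) @[n --> \oo] --> f1 + g1.
Proof.
move=> af ag.
have -> : (fun n => a n * (f n + g n - (f0 + g0))) =
    (fun n => a n * (f n - f0) + a n * (g n - g0)).
  by apply/funext => n; ring.
exact: cvgD.
Qed.

Lemma rate_cst a (c : R) : a n * (c - c) @[n --> \oo] --> (0 : R).
Proof. by under eq_fun do rewrite subrr mulr0; exact: cvg_cst. Qed.

Lemma expansionW a (k l : nat) (f : nat -> R -> R) (f0 f1 : R -> R) :
  (k <= l)%N -> expansion a k f f0 f1 -> expansion a l f f0 f1.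
Proof.
move=> kl exf e e0; near=> n => z.
apply: (@le_trans _ _ (e * (1 + z ^+ 2) ^+ k)).
  by move: z; near: n; exact: exf.
by rewrite ler_pM2l// ler_weXn2l// lerDl sqr_ge0.
Unshelve. all: by end_near. Qed.

(* A primitive of [- (1 + z ^+ 2) ^+ 3 * expR (- z)]; its polynomial factor is the
   sum of all derivatives of [(1 + z ^+ 2) ^+ 3]. *)
Definition weight_tail (z : R) : R :=
  ((((((z + 6) * z + 33) * z + 132) * z + 399) * z + 798) * z + 799) * expR (- z).

Lemma has_derive_weight_tail z :
  has_derive weight_tail z (- ((1 + z ^+ 2) ^+ 3 * expR (- z))).
Proof.
apply: has_derive_eq; first by rewrite /weight_tail; solve_derive.
by cbv beta; ring.
Qed.

Lemma weight_tail_ge0 z : 0 <= weight_tail z.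
Proof.
apply: mulr_ge0; last exact: expR_ge0.
(* The polynomial is the first square plus 24 times the second plus 210 times the third plus 7.5 z^2
   + 40.9. *)
have := sqr_ge0 (z ^+ 3 + 3 * z ^+ 2); have := sqr_ge0 (z ^+ 2 + 11 / 4 * z).
have := sqr_ge0 (z + 19 / 10); have := sqr_ge0 z.
move=> h1 h2 h3 h4; lra.
Qed.

(** Both [f] and [- f] grow more slowly than [- e * weight_tail] on [x, t]; drop [weight_tail t],
    which is nonnegative, and let [t] tend to infinity. *)
Lemma tail_bound (f f' : R -> R) (e l x : R) : 0 <= e ->
  (forall t, x <= t -> has_derive f t (f' t)) ->
  (forall t, x <= t -> `|f' t| <= e * ((1 + t ^+ 2) ^+ 3 * expR (- t))) ->
  f t @[t --> +oo] --> l -> `|f x - l| <= e * weight_tail x.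
Proof.
move=> e0 df f'le fl.
have W t : x <= t -> `|f t - f x| <= e * weight_tail x.
  move=> xt.
  have dW s : has_derive (fun t => - (e * weight_tail t)) s
      (e * ((1 + s ^+ 2) ^+ 3 * expR (- s))).
    apply: has_derive_eq.
      by apply: has_deriveN; apply: has_deriveM; [exact: has_derive_cst|exact: has_derive_weight_tail].
    by cbv beta; ring.
  have Wt : 0 <= e * weight_tail t by rewrite mulr_ge0 ?weight_tail_ge0.
  have le1 : f t - f x <= - (e * weight_tail t) - - (e * weight_tail x).
    apply: (@has_derive_le R f (fun s => - (e * weight_tail s)) f'
      (fun s => e * ((1 + s ^+ 2) ^+ 3 * expR (- s))) _ _ xt) => s /andP[xs _]; [exact: df|exact: dW|].
    exact: le_trans (ler_norm _) (f'le s xs).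
  have le2 : - f t - - f x <= - (e * weight_tail t) - - (e * weight_tail x).
    apply: (@has_derive_le R (fun s => - f s) (fun s => - (e * weight_tail s)) (fun s => - f' s)
      (fun s => e * ((1 + s ^+ 2) ^+ 3 * expR (- s))) _ _ xt) => s /andP[xs _].
    - by apply: has_deriveN; exact: df.
    - exact: dW.
    - by rewrite (le_trans _ (f'le s xs))// -normrN ler_norm.
  by rewrite ler_norml; apply/andP; split; lra.
move/cvgrPdist_le in fl; apply/ler_addgt0Pr => r r0; near (pinfty_nbhs R) => t.
have xt : x <= t by near: t; apply: nbhs_pinfty_ge; rewrite num_real.
have lt : `|l - f t| <= r by near: t; exact: fl.
rewrite -normrN (_ : - (f x - l) = (f t - f x) + (l - f t)); last by ring.
by rewrite (le_trans (ler_normD _ _))// lerD// W.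
Unshelve. all: by end_near. Qed.

(** The function a n (X n - X0) - X1 has as derivative minus the error of the expansion times
    exp(-z), so [tail_bound] applies. Its value [l n] at infinity may depend on [n] and need not
    converge. *)
Lemma tail_expansion a (f : nat -> R -> R) (f0 f1 : R -> R) (X : nat -> R -> R)
    (X0 X1 : R -> R) (l : nat -> R) (x : R) :
  expansion a 3 f f0 f1 ->
  (\forall n \near \oo, forall z, has_derive (X n) z (- (f n z * expR (- z)))) ->
  (forall z, has_derive X0 z (- (f0 z * expR (- z)))) ->
  (forall z, has_derive X1 z (- (f1 z * expR (- z)))) ->
  (\forall n \near \oo, a n * (X n z - X0 z) - X1 z @[z --> +oo] --> l n) ->
  a n * (X n x - X0 x) - X1 x - l n @[n --> \oo] --> (0 : R).
Proof.
move=> exf dX dX0 dX1 lim; apply/cvgr0Pnorm_le => e e0.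
(* The added 1 keeps the denominator positive. *)
pose d := e / (weight_tail x + 1).
have W0 := weight_tail_ge0 x.
have d0 : 0 < d by rewrite divr_gt0//; lra.
near=> n.
apply: (@le_trans _ _ (d * weight_tail x)); last first.
  by rewrite /d mulrAC ler_pdivrMr; [nra|lra].
have dXn : forall z, has_derive (X n) z (- (f n z * expR (- z))) by near: n.
apply: (@tail_bound (fun z => a n * (X n z - X0 z) - X1 z) (fun z => - (a n * (f n z - f0 z) - f1 z) * expR (- z))).
- exact: ltW.
- move=> t _; apply: has_derive_eq; first by solve_derive.
  by cbv beta; ring.
- move=> t _; rewrite normrM normrN (gtr0_norm (expR_gt0 _)) mulrA.
  rewrite ler_pM2r ?expR_gt0//; move: t; near: n; exact: exf.
- by near: n.
Unshelve. all: by end_near. Qed.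

End rates.

(** * Mills' ratio and the levels b_n *)

Section gaussian_levels.
Context {R : realType}.
Implicit Types (b : nat -> R).

(** Two terms of the asymptotic series of Mills' ratio. The derivative of [G] is - phi(s) (1 - 3 /
    s^4) >= - phi(s), so G t - G T <= Phi T - Phi t, and G T <= 1 / T vanishes at infinity. *)
Lemma mills_ge (t : R) : 1 <= t -> phi t * (t^-1 * (1 - t^-1 ^+ 2)) <= 1 - Phi t.
Proof.
move=> t1; set G := fun t : R => phi t * (t^-1 * (1 - t^-1 ^+ 2)).
have dG s : 1 <= s -> has_derive G s (- phi s * (1 - 3 * (s^-1 ^+ 2) ^+ 2)).
  move=> s1; have s0 : s != 0 by rewrite gt_eqF//; lra.
  by apply: has_derive_eq; [rewrite /G; solve_derive; exact: s0|cbv beta; field].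
have T_le T : t <= T -> G t - T^-1 <= 1 - Phi t.
  move=> tT; have T1 : 1 <= T by lra.
  have : - G T - - G t <= Phi T - Phi t.
    apply: (@has_derive_le R (fun t => - G t) (@Phi R)
      (fun s => - (- phi s * (1 - 3 * (s^-1 ^+ 2) ^+ 2))) (@phi R)) => // s /andP[ts sT].
    - by apply/has_deriveN/dG; lra.
    - exact: has_derive_Phi.
    - rewrite mulNr opprK ger_pMr ?phi_gt0//.
      by have := sqr_ge0 (s^-1 ^+ 2); lra.
  have iT : 0 < T^-1 by rewrite invr_gt0; lra.
  have : G T <= T^-1.
    have i1 : T^-1 <= 1 by rewrite invf_le1//; lra.
    rewrite /G; set i := T^-1 in iT i1 *.
    have i2 : 0 <= 1 - i ^+ 2 by nra.
    have : phi T * (i * (1 - i ^+ 2)) <= 1 * (i * (1 - i ^+ 2)).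
      by rewrite ler_wpM2r ?phi_le1// mulr_ge0// ltW.
    by nra.
  by have := Phi_le1 T; lra.
rewrite -/(G t) leNgt; apply/negP => h.
have d0 : 0 < G t - (1 - Phi t) by lra.
(* This makes 1 / T at most half of the supposed gap. *)
have := T_le (Num.max t (2 / (G t - (1 - Phi t)))).
rewrite le_max lexx => /(_ isT).
set T := Num.max _ _; have T0 : 0 < T by rewrite lt_max; apply/orP; left; lra.
have : T^-1 <= (2 / (G t - (1 - Phi t)))^-1.
  by rewrite lef_pV2 ?posrE ?divr_gt0// le_max lexx orbT.
rewrite invf_div; lra.
Qed.

(** A third term of the series turns the derivative into - phi(s) (1 + 15 / s^6) <= - phi(s) and
    reverses the comparison. The two bounds differ by a relative 3 / t^4, negligible against the
    t^-2 that determines the rate of c_n. *)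
Lemma mills_le (t : R) : 1 <= t ->
  1 - Phi t <= phi t * (t^-1 * (1 - t^-1 ^+ 2 + 3 * (t^-1 ^+ 2) ^+ 2)).
Proof.
move=> t1; set H := fun t : R => phi t * (t^-1 * (1 - t^-1 ^+ 2 + 3 * (t^-1 ^+ 2) ^+ 2)).
have dH s : 1 <= s -> has_derive H s (- phi s * (1 + 15 * (s^-1 ^+ 2) ^+ 2 * s^-1 ^+ 2)).
  move=> s1; have s0 : s != 0 by rewrite gt_eqF//; lra.
  by apply: has_derive_eq; [rewrite /H; solve_derive; exact: s0|cbv beta; field].
have T_le T : t <= T -> Phi T - Phi t <= H t.
  move=> tT; have T1 : 1 <= T by lra.
  have : Phi T - Phi t <= - H T - - H t.
    apply: (@has_derive_le R (@Phi R) (fun t => - H t) (@phi R)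
      (fun s => - (- phi s * (1 + 15 * (s^-1 ^+ 2) ^+ 2 * s^-1 ^+ 2)))) => // s /andP[ts sT].
    - exact: has_derive_Phi.
    - by apply/has_deriveN/dH; lra.
    - rewrite mulNr opprK ler_peMr ?(ltW (phi_gt0 _))// lerDl.
      by apply: mulr_ge0 (sqr_ge0 _); apply: mulr_ge0 (sqr_ge0 _); lra.
  have : 0 <= H T.
    apply: mulr_ge0 (ltW (phi_gt0 _)) _; apply: mulr_ge0; first by rewrite invr_ge0; lra.
    by have := sqr_ge0 (T^-1 ^+ 2 - 1 / 2); have := sqr_ge0 (T^-1 ^+ 2); lra.
  by lra.
rewrite -/(H t); apply/ler_addgt0Pr => e e0; near (pinfty_nbhs R) => T.
have tT : t <= T by near: T; apply: nbhs_pinfty_ge; rewrite num_real.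
have : `|1 - Phi T| <= e.
  by near: T; have /cvgrPdist_le := @cvg_Phi R; exact.
have := T_le _ tT; have := ler_norm (1 - Phi T); lra.
Unshelve. all: by end_near. Qed.

Section levels.
Variable b : nat -> R.
Hypothesis hb : forall n : nat, (3 <= n)%N -> n%:R * (1 - Phi (b n)) = 1.

Lemma cvg_level : b n @[n --> \oo] --> +oo.
Proof.
apply/cvgryPge => M; near=> n.
have n3 : (3 <= n)%N by near: n; exact: nbhs_infty_ge.
have n0 : 0 < n%:R :> R by rewrite ltr0n (leq_trans _ n3).
(* Then n (1 - Phi M) >= 1, whereas b n < M would give n (1 - Phi M) < n (1 - Phi (b n)) = 1. *)
have nM : (1 - Phi M)^-1 <= n%:R by near: n; exact: nbhs_infty_ger.
rewrite leNgt; apply/negP => /Phi_lt bM.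
have := hb n3; have := Phi_lt1 M => M1.
rewrite -[_^-1]div1r ler_pdivrMr in nM; last by lra.
by nra.
Unshelve. all: by end_near. Qed.

Lemma cvg_level_sqr : b n ^+ 2 @[n --> \oo] --> +oo.
Proof.
apply/cvgryPge => M; near=> n.
have : 1 <= b n by near: n; exact: (cvgry_ge cvg_level).
have : M <= b n by near: n; exact: (cvgry_ge cvg_level).
by nra.
Unshelve. all: by end_near. Qed.

(** As n = 1 / (1 - Phi (b n)), the reciprocal of c_n is Mills' ratio times b n, squeezed with rate
    -1. The delta method for the inverse at 1 flips the sign. *)
Lemma rate_level_density :
  b n ^+ 2 * (n%:R * phi (b n) / b n - 1) @[n --> \oo] --> (1 : R).
Proof.
have rr : b n ^+ 2 * ((1 - Phi (b n)) * b n / phi (b n) - 1) @[n --> \oo] --> (-1 : R).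
  apply: (@squeeze_cvgr _ _ _ _ (fun=> -1) (fun n => -1 + 3 * (b n ^+ 2)^-1)).
  - near=> n.
    have b1 : 1 <= b n by near: n; exact: (cvgry_ge cvg_level).
    have b0 : 0 < b n by lra.
    have p0 := phi_gt0 (b n).
    have := mills_ge b1; have := mills_le b1.
    have i0 : 0 < (b n)^-1 by rewrite invr_gt0.
    set r := _ / phi (b n).
    have -> : 1 - Phi (b n) = phi (b n) * ((b n)^-1 * r) by rewrite /r; field; rewrite !gt_eqF.
    rewrite !ler_pM2l// => r1 r2.
    have bi : b n ^+ 2 * (b n)^-1 ^+ 2 = 1 by rewrite -exprMn mulfV ?gt_eqF// expr1n.
    have b2 : 0 < b n ^+ 2 by rewrite exprn_gt0.
    have -> : -1 + 3 / b n ^+ 2 = b n ^+ 2 * (- (b n)^-1 ^+ 2 + 3 * ((b n)^-1 ^+ 2) ^+ 2).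
      by field; rewrite gt_eqF.
    have -> : -1 = b n ^+ 2 * (- (b n)^-1 ^+ 2) by rewrite mulrN bi.
    by rewrite !ler_pM2l//; apply/andP; split; lra.
  - exact: cvg_cst.
  - apply: cvg_to_eq.
      apply: cvgD; first exact: cvg_cst.
      by apply: cvgM; [exact: cvg_cst|exact: (cvg_rate_inv cvg_level_sqr)].
    by rewrite mulr0 addr0.
have := rate_delta cvg_level_sqr rr (has_deriveV (oner_neq0 R) (has_derive_id 1)).
rewrite expr1n invr1 mulr1 mulrNN mulr1.
apply: cvg_trans; apply: near_eq_cvg; near=> n.
have n3 : (3 <= n)%N by near: n; exact: nbhs_infty_ge.
have p0 := phi_gt0 (b n).
have n0 : 0 < n%:R :> R by rewrite ltr0n (leq_trans _ n3).
have b0 : 0 < b n by near: n; exact: (cvgry_gt cvg_level).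
have -> : 1 - Phi (b n) = n%:R^-1.
  by have := hb n3 => /(congr1 (fun t => n%:R^-1 * t)); rewrite mulKf ?gt_eqF// mulr1.
by field; rewrite !gt_eqF.
Unshelve. all: by end_near. Qed.

(** 1 / n = 1 - Phi (b n) <= phi (b n) / b n, and b^2 phi(b) <= 2 by [phi_le]. *)
Lemma cvg_level_sqr_div : b n ^+ 2 / n%:R @[n --> \oo] --> (0 : R).
Proof.
apply: (@squeeze_cvgr _ _ _ _ (fun=> 0) (fun n => 2 / b n)).
- near=> n.
  have n3 : (3 <= n)%N by near: n; exact: nbhs_infty_ge.
  (* From 2 on, the correcting factor in [mills_le] is at most 1. *)
  have b1 : 2 <= b n by near: n; exact: (cvgry_ge cvg_level).
  have n0 : 0 < n%:R :> R by rewrite ltr0n (leq_trans _ n3).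
  have b0 : 0 < b n by lra.
  rewrite divr_ge0 ?sqr_ge0 ?ler0n//=.
  have -> : n%:R^-1 = 1 - Phi (b n).
    by have := hb n3 => /(congr1 (fun t => n%:R^-1 * t)); rewrite mulKf ?gt_eqF// mulr1.
  rewrite ler_pdivlMr//.
  have b1' : 1 <= b n by lra.
  have := mills_le b1'; set q := 1 - Phi _ => qle.
  have p0 := phi_gt0 (b n); have := phi_le (b n).
  have i0 : 0 < (b n)^-1 by rewrite invr_gt0.
  have bi : b n * (b n)^-1 = 1 by rewrite mulfV ?gt_eqF.
  have i2 : (b n)^-1 ^+ 2 <= 1 / 4.
    have : (b n)^-1 <= 1 / 2 by nra.
    by nra.
  have qb : q * b n <= phi (b n).
    rewrite -ler_pdivlMr// (le_trans qle)// ler_pM2l// ler_piMr ?(ltW i0)//.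
    by have := sqr_ge0 (b n)^-1; nra.
  have : b n ^+ 2 * (q * b n) <= b n ^+ 2 * phi (b n) by rewrite ler_pM2l// exprn_gt0.
  move=> h1 h2; have : b n ^+ 2 * q * b n = b n ^+ 2 * (q * b n) by rewrite mulrA.
  by move=> ->; lra.
- exact: cvg_cst.
- apply: cvg_to_eq.
    apply: cvgM; first exact: cvg_cst.
    by apply/gtr0_cvgV0; [exact: (cvgry_gt cvg_level)|exact: cvg_level].
  by rewrite mulr0.
Unshelve. all: by end_near. Qed.

End levels.

Lemma dist_expn_le (x y : R) (n : nat) : 0 <= x <= 1 -> 0 <= y <= 1 ->
  `|x ^+ n - y ^+ n| <= n%:R * `|x - y|.
Proof.
move=> /andP[x0 x1] /andP[y0 y1]; elim: n => [|n IHn]; first by rewrite !expr0 subrr normr0 mul0r.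
rewrite !exprS (_ : _ - _ = x * (x ^+ n - y ^+ n) + (x - y) * y ^+ n); last by ring.
rewrite (le_trans (ler_normD _ _))// -natr1 [leRHS]mulrDl mul1r lerD//.
  by rewrite normrM ger0_norm// (le_trans _ IHn)// ler_piMl.
by rewrite normrM ler_piMr// ger0_norm ?exprn_ge0// exprn_ile1.
Qed.

End gaussian_levels.

(** * The Huesler-Reiss exponent *)

Section husler_reiss_expansion.
Context {R : realType}.
Implicit Types (a b rho : nat -> R) (lambda alpha x y z : R).

Definition hr_arg lambda (x y : R) : R := lambda + (y - x) / (2 * lambda).

Definition hr_exponent lambda (x y : R) : R :=
  Phi (hr_arg lambda x y) * expR (- x) + Phi (hr_arg lambda y x) * expR (- y).

Lemma husler_reissE lambda x y :
  husler_reiss lambda x y = expR (- hr_exponent lambda x y).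
Proof. by congr expR; rewrite /hr_exponent /hr_arg; ring. Qed.

(** The squares of the two arguments differ by 2 (y - x). *)
Lemma phi_hr_arg_swap lambda x y : lambda != 0 ->
  phi (hr_arg lambda y x) * expR (- y) = phi (hr_arg lambda x y) * expR (- x).
Proof.
move=> l0; rewrite !phiE -!mulrA -!expRD; congr (_ * expR _).
by rewrite /hr_arg; field.
Qed.

(** The density terms from the two [Phi] cancel by [phi_hr_arg_swap]. *)
Lemma has_derive_hr_exponent lambda y z : lambda != 0 ->
  has_derive (fun x => hr_exponent lambda x y) z
    (- (Phi (hr_arg lambda z y) * expR (- z))).
Proof.
move=> l0; apply: has_derive_eq; first by rewrite /hr_exponent /hr_arg; solve_derive.
cbv beta; rewrite -/(hr_arg lambda z y) -/(hr_arg lambda y z).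
have := phi_hr_arg_swap z y l0.
move: (phi (hr_arg lambda z y)) (phi (hr_arg lambda y z)) => p q qp.
have -> : q = p * expR (- z) / expR (- y) by rewrite -qp mulfK// gt_eqF// expR_gt0.
by field; rewrite l0 gt_eqF ?expR_gt0.
Qed.

(* [hr_p1 + hr_q1 * z] is the limit of [b n ^+ 2 * (A_n z - hr_arg lambda z y)], where
   [A_n z] is the affine function of [z] given by [slice_arg]. *)
Definition hr_p1 lambda alpha y : R :=
  lambda ^+ 2 / 2 * (lambda + y / (2 * lambda)) - alpha + y / 2 * (alpha / lambda ^+ 2).
Definition hr_q1 lambda alpha : R :=
  - (lambda / 4) + lambda - alpha / (2 * lambda ^+ 2).

(** The 1 is the rate of c_n, - z^2 / 2 comes from the Gaussian factor, and the [phi] term from the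
    expansion of the affine argument. *)
Lemma has_derive_kappa lambda alpha y z : lambda != 0 ->
  has_derive (fun x => kappa alpha lambda x y) z
    (((1 - z ^+ 2 / 2) * Phi (hr_arg lambda z y)
      + phi (hr_arg lambda z y) * (hr_p1 lambda alpha y + hr_q1 lambda alpha * z))
     * expR (- z)).
Proof.
move=> l0; apply: has_derive_eq; first by rewrite /kappa /s; solve_derive.
cbv beta; rewrite -/(hr_arg lambda z y) -/(hr_arg lambda y z).
have := phi_hr_arg_swap z y l0.
move: (phi (hr_arg lambda z y)) (phi (hr_arg lambda y z)) => p q qp.
move: (Phi (hr_arg lambda z y)) (Phi (hr_arg lambda y z)) => P Q.
have -> : q = p * expR (- z) / expR (- y) by rewrite -qp mulfK// gt_eqF// expR_gt0.
rewrite /hr_p1 /hr_q1 /hr_arg; field.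
by rewrite l0 gt_eqF ?expR_gt0.
Qed.

(** * The affine argument of [Phi] in the derivative, and the rates of its coefficients *)

Section slice.
Variables (b rho : nat -> R) (lambda alpha : R).
Hypothesis hrho : forall n : nat, -1 <= rho n <= 1.
Hypothesis hlambda : 0 < lambda.
Hypothesis cvg_b : b n @[n --> \oo] --> +oo.
Hypothesis cvg_a : b n ^+ 2 @[n --> \oo] --> +oo.
Hypothesis hlim :
  b n ^+ 2 * (lambda - hr_lambda (b n) (rho n)) @[n --> \oo] --> alpha.

Let l n := hr_lambda (b n) (rho n).
Let a n := b n ^+ 2.
(** The small parameter: 1 - rho n = 2 w n gives 1 - rho^2 = 4 w (1 - w), whose square root is (2 l
    / b) sqrt(1 - w). *)
Let w n := l n ^+ 2 / a n.

Let rate_l : a n * (l n - lambda) @[n --> \oo] --> - alpha.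
Proof.
have -> : (fun n => a n * (l n - lambda)) = (fun n => - (a n * (lambda - l n))).
  by apply/funext => n; ring.
exact: cvgN.
Qed.

Let cvg_l : l n @[n --> \oo] --> lambda.
Proof. exact: rate_cvg rate_l. Qed.

Let rate_w : a n * (w n - 0) @[n --> \oo] --> lambda ^+ 2.
Proof.
have : l n * l n @[n --> \oo] --> lambda ^+ 2 by rewrite expr2; exact: cvgM.
apply: cvg_trans; apply: near_eq_cvg; near=> n.
have a0 : 0 < a n by near: n; exact: (cvgry_gt cvg_a).
by rewrite /w; field; rewrite gt_eqF.
Unshelve. all: by end_near. Qed.

(** As [l n] tends to [lambda] > 0 and [w n] to 0, [rho n] is eventually neither 1 nor -1, and the
    slice formula becomes available. *)
Lemma hr_regular : \forall n \near \oo,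
  [/\ 0 < b n, -1 < rho n < 1, 0 < l n, 1 - rho n = 2 * w n & 0 < 1 - w n].
Proof.
have cw := rate_cvg cvg_a rate_w.
near=> n.
have b0 : 0 < b n by near: n; exact: (cvgry_gt cvg_b).
have l0 : 0 < l n by near: n; exact: (cvgr_gt _ cvg_l).
have w1 : w n < 1 by near: n; exact: (cvgr_lt _ cw).
have /andP[r1 r2] := hrho n.
have rw : 1 - rho n = 2 * w n.
  rewrite /w /l /hr_lambda sqr_sqrtr; first by rewrite /a; field; rewrite gt_eqF.
  by rewrite mulr_ge0 ?subr_ge0// mulr_ge0 ?sqr_ge0// invr_ge0.
have w0 : 0 < w n by rewrite divr_gt0// exprn_gt0.
split => //; last lra.
by apply/andP; split; lra.
Unshelve. all: by end_near. Qed.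

Let r n := (Num.sqrt (1 - w n))^-1.
(** Products and sums arranged for [rateM] and [rateD]. *)
Definition slice_p y n := r n * (l n + y / 2 * (l n)^-1).
Definition slice_q n := r n * (l n / a n + - 2^-1 * (l n)^-1).

Lemma slice_arg y z n :
  0 < b n -> 0 < l n -> 1 - rho n = 2 * w n -> 0 < 1 - w n ->
  (norming (b n) y - rho n * norming (b n) z) / Num.sqrt (1 - rho n ^+ 2) =
  slice_p y n + slice_q n * z.
Proof.
move=> b0 l0 rw w1.
have rE : rho n = 1 - 2 * w n by lra.
have -> : 1 - rho n ^+ 2 = (2 * l n / b n) ^+ 2 * (1 - w n).
  by rewrite rE /w /a; field; rewrite gt_eqF.
rewrite sqrtrM ?sqr_ge0// sqrtr_sqr gtr0_norm ?divr_gt0// ?mulr_gt0//.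
rewrite /slice_p /slice_q /r.
have s0 : 0 < Num.sqrt (1 - w n) by rewrite sqrtr_gt0.
move: (Num.sqrt _) s0 => q q0.
rewrite rE /norming /w /a; field.
by rewrite !gt_eqF.
Qed.

Let rate_r : a n * (r n - 1) @[n --> \oo] --> lambda ^+ 2 / 2.
Proof.
have d : has_derive (fun t : R => (Num.sqrt (1 - t))^-1) 0 (1 / 2).
  apply: has_derive_eq.
    apply: has_deriveV; first by rewrite subr0 sqrtr1 oner_neq0.
    apply: has_derive_comp; first by apply: is_derive1_sqrt; rewrite subr0.
    by solve_derive.
  by cbv beta; rewrite subr0 sqrtr1; field.
apply: cvg_to_eq; first by have := rate_delta cvg_a rate_w d; rewrite subr0 sqrtr1 invr1; apply.
by field.
Qed.

Let rate_linv : a n * ((l n)^-1 - lambda^-1) @[n --> \oo] --> alpha / lambda ^+ 2.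
Proof.
apply: cvg_to_eq; first exact: (rate_delta cvg_a rate_l (has_derive_inv (lt0r_neq0 hlambda))).
by field; rewrite gt_eqF.
Qed.

Let rate_la : a n * (l n / a n - 0) @[n --> \oo] --> lambda.
Proof.
apply: cvg_trans cvg_l; apply: near_eq_cvg; near=> n.
have a0 : 0 < a n by near: n; exact: (cvgry_gt cvg_a).
by field; rewrite gt_eqF.
Unshelve. all: by end_near. Qed.

Lemma rate_slice_p y :
  a n * (slice_p y n - (lambda + y / (2 * lambda))) @[n --> \oo] -->
  hr_p1 lambda alpha y.
Proof.
have := rateM cvg_a rate_r (rateD rate_l (rateM cvg_a (rate_cst a (y / 2)) rate_linv)).
rewrite (_ : 1 * _ = lambda + y / (2 * lambda)); last by field; rewrite gt_eqF.
move=> /cvg_to_eq; apply.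
by rewrite /hr_p1; field; rewrite gt_eqF.
Qed.

Lemma rate_slice_q :
  a n * (slice_q n - (- (2 * lambda)^-1)) @[n --> \oo] --> hr_q1 lambda alpha.
Proof.
have := rateM cvg_a rate_r (rateD rate_la (rateM cvg_a (rate_cst a (- 2^-1)) rate_linv)).
rewrite (_ : 1 * _ = - (2 * lambda)^-1); last by field; rewrite gt_eqF.
move=> /cvg_to_eq; apply.
by rewrite /hr_q1; field; rewrite gt_eqF.
Qed.

End slice.

End husler_reiss_expansion.

(** * Limits at infinity *)

Section limits_at_infinity.
Context {R : realType}.
Implicit Types (b : R) (lambda alpha x y z : R).

Lemma cvgM0_bounded (T : Type) (F : set_system T) {FF : Filter F} (f g : T -> R) :
  f t @[t --> F] --> 0 -> (forall t, `|g t| <= 1) -> f t * g t @[t --> F] --> 0.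
Proof.
move=> /cvgr0Pnorm_le f0 g1; apply/cvgr0Pnorm_le => e e0; near=> t.
by rewrite normrM (le_trans (ler_piMr _ (g1 t)))//; near: t; exact: f0.
Unshelve. all: by end_near. Qed.

Lemma norm_Phi_le1 z : `|Phi z| <= 1.
Proof. by rewrite ger0_norm ?Phi_ge0 ?Phi_le1. Qed.

Lemma norm_phi_le1 z : `|phi z| <= 1.
Proof. by rewrite ger0_norm ?phi_le1 ?ltW ?phi_gt0. Qed.

Lemma cvg_invr_pinfty : z^-1 @[z --> +oo] --> (0 : R).
Proof.
apply/gtr0_cvgV0; last exact: cvg_id.
by near=> z; near: z; apply: nbhs_pinfty_gt; rewrite num_real.
Unshelve. all: by end_near. Qed.

(** exp z = (exp (z / 3))^3 >= (z / 3)^3, hence the bound 27 / z. *)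
Lemma cvg_sqr_expRN : z ^+ 2 * expR (- z) @[z --> +oo] --> (0 : R).
Proof.
apply: (@squeeze_cvgr _ _ _ _ (fun=> 0) (fun z => 27 * z^-1)).
- near=> z.
  have z0 : 0 < z by near: z; apply: nbhs_pinfty_gt; rewrite num_real.
  rewrite mulr_ge0 ?sqr_ge0 ?expR_ge0//= expRN ler_pdivrMr ?expR_gt0//.
  have -> : expR z = expR (z / 3) ^+ 3 by rewrite -expRM_natl; congr expR; field.
  have e3 : z / 3 <= expR (z / 3) by have := expR_ge1Dx (z / 3); lra.
  have : (z / 3) ^+ 3 <= expR (z / 3) ^+ 3 by rewrite ler_pXn2r// nnegrE ?expR_ge0// divr_ge0// ltW.
  rewrite (_ : z ^+ 2 = 27 * z^-1 * (z / 3) ^+ 3); last by field; rewrite gt_eqF.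
  by move=> h; rewrite ler_wpM2l// mulr_ge0// invr_ge0 ltW.
- exact: cvg_cst.
- apply: cvg_to_eq; first by apply: cvgM; [exact: cvg_cst|exact: cvg_invr_pinfty].
  by rewrite mulr0.
Unshelve. all: by end_near. Qed.

Lemma cvg_expRN : expR (- z) @[z --> +oo] --> (0 : R).
Proof.
apply: (@squeeze_cvgr _ _ _ _ (fun=> 0) (fun z => z ^+ 2 * expR (- z))).
- near=> z.
  have z1 : 1 <= z by near: z; apply: nbhs_pinfty_ge; rewrite num_real.
  by rewrite expR_ge0/= ler_peMl ?expR_ge0// expr_ge1//; lra.
- exact: cvg_cst.
- exact: cvg_sqr_expRN.
Unshelve. all: by end_near. Qed.

Lemma cvg_id_expRN : z * expR (- z) @[z --> +oo] --> (0 : R).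
Proof.
apply: (@squeeze_cvgr _ _ _ _ (fun=> 0) (fun z => z ^+ 2 * expR (- z))).
- near=> z.
  have z1 : 1 <= z by near: z; apply: nbhs_pinfty_ge; rewrite num_real.
  rewrite mulr_ge0 ?expR_ge0//=.
  by rewrite ler_pM2r ?expR_gt0//; nra.
- exact: cvg_cst.
- exact: cvg_sqr_expRN.
Unshelve. all: by end_near. Qed.

Lemma cvg_s : s z @[z --> +oo] --> (0 : R).
Proof.
have -> : @s R = (fun z => 2^-1 * (z ^+ 2 * expR (- z)) + z * expR (- z)).
  by apply/funext => z; rewrite /s; field.
rewrite -[X in _ --> X](addr0 0) -[X in _ --> X + _](mulr0 2^-1).
by apply: cvgD; [apply: cvgM; [exact: cvg_cst|exact: cvg_sqr_expRN]|exact: cvg_id_expRN].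
Qed.

Lemma cvg_affine_pinfty (c d : R) : 0 < d -> c + d * z @[z --> +oo] --> +oo.
Proof.
move=> d0; apply/cvgryPge => M; near=> z.
rewrite -lerBlDl -ler_pdivrMl//; near: z; apply: nbhs_pinfty_ge; rewrite num_real//.
Unshelve. all: by end_near. Qed.

Lemma cvg_Phi_affine (c d : R) : 0 < d -> Phi (c + d * z) @[z --> +oo] --> (1 : R).
Proof. by move=> d0; apply: cvg_comp (cvg_affine_pinfty c d0) cvg_Phi. Qed.

Lemma cvg_Phi_norming b : 0 < b -> Phi (norming b z) @[z --> +oo] --> (1 : R).
Proof.
move=> b0; rewrite /norming; under eq_fun do rewrite mulrC.
by apply: cvg_Phi_affine; rewrite invr_gt0.
Qed.

Lemma cvg_Phi_hr_arg lambda y : 0 < lambda ->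
  Phi (hr_arg lambda y z) @[z --> +oo] --> (1 : R).
Proof.
move=> l0.
have -> : (fun z => Phi (hr_arg lambda y z)) =
    (fun z => Phi (lambda - y / (2 * lambda) + (2 * lambda)^-1 * z)).
  by apply/funext => z; congr Phi; rewrite /hr_arg; field; rewrite gt_eqF.
by apply: cvg_Phi_affine; rewrite invr_gt0; lra.
Qed.

Lemma cvg_hr_exponent lambda y : 0 < lambda ->
  hr_exponent lambda z y @[z --> +oo] --> expR (- y).
Proof.
move=> l0; rewrite -[X in _ --> X]add0r -[X in _ --> _ + X]mul1r.
apply: cvgD.
  under eq_fun do rewrite mulrC.
  by apply: cvgM0_bounded; [exact: cvg_expRN|move=> z; exact: norm_Phi_le1].
by apply: cvgM; [exact: cvg_Phi_hr_arg|exact: cvg_cst].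
Qed.

(** What survives is the second-order term of the margin in y, so that it cancels against
    [rate_marginal_tail]. *)
Lemma cvg_kappa alpha lambda y : 0 < lambda ->
  kappa alpha lambda z y @[z --> +oo] --> s y.
Proof.
move=> l0; rewrite -[X in _ --> X]addr0 -[X in _ --> X + _]add0r -[X in _ --> _ + X + _]mulr1.
apply: cvgD; first apply: cvgD.
- by apply: cvgM0_bounded; [exact: cvg_s|move=> z; exact: norm_Phi_le1].
- by apply: cvgM; [exact: cvg_cst|exact: cvg_Phi_hr_arg].
- apply: cvgM0_bounded; last by move=> z; exact: norm_phi_le1.
  have -> : (fun z => (2 * alpha - lambda * (lambda ^+ 2 + z + y + 2)) * expR (- z)) =
     (fun z => (2 * alpha - lambda * (lambda ^+ 2 + y + 2)) * expR (- z)
               + - lambda * (z * expR (- z))).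
    by apply/funext => z; ring.
  rewrite -[X in _ --> X](addr0 0).
  rewrite -[X in _ --> X + _](mulr0 (2 * alpha - lambda * (lambda ^+ 2 + y + 2))).
  rewrite -[X in _ --> _ + X](mulr0 (- lambda)).
  by apply: cvgD; apply: cvgM; try exact: cvg_cst; [exact: cvg_expRN|exact: cvg_id_expRN].
Qed.

Lemma cvg_gauss2_cdf_norming rho b v : 0 < b -> -1 < rho < 1 ->
  gauss2_cdf rho (norming b z) v @[z --> +oo] --> Phi v.
Proof.
move=> b0 rho1; apply/cvgrPdist_le => e e0; near=> z.
rewrite distrC (le_trans (gauss2_cdf_margin _ _ rho1))//.
apply: le_trans (ler_norm _) _; near: z.
have /cvgrPdist_le := cvg_Phi_norming b0; exact.
Unshelve. all: by end_near. Qed.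

Lemma phi_norming b z : b != 0 ->
  phi (norming b z) = phi b * (expR (- z) * expR (- (z ^+ 2 / (2 * b ^+ 2)))).
Proof.
move=> b0; rewrite !phiE -mulrA -!expRD; congr (_ * expR _).
by rewrite /norming; field.
Qed.

Lemma has_derive_norming b z : has_derive (norming b) z b^-1.
Proof. by apply: has_derive_eq; [rewrite /norming; solve_derive|cbv beta; ring]. Qed.

End limits_at_infinity.

(** * Convergence rates *)

Section tail_asymptotics.
Context {R : realType}.
Variables (b rho : nat -> R) (lambda alpha : R).
Hypothesis hb : forall n : nat, (3 <= n)%N -> n%:R * (1 - Phi (b n)) = 1.
Hypothesis hrho : forall n : nat, -1 <= rho n <= 1.
Hypothesis hlambda : 0 < lambda.
Hypothesis hlim :
  b n ^+ 2 * (lambda - hr_lambda (b n) (rho n)) @[n --> \oo] --> alpha.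

Let a n := b n ^+ 2.
Let cvg_b : b n @[n --> \oo] --> +oo := cvg_level hb.
Let cvg_a : a n @[n --> \oo] --> +oo := cvg_level_sqr hb.

(** (1 - z^2 / 2) exp(-z) is the derivative of [s], and everything vanishes at infinity:
    [tail_expansion] applies with [l] = 0. *)
Lemma rate_marginal_tail y :
  a n * (n%:R * (1 - Phi (norming (b n) y)) - expR (- y)) + s y @[n --> \oo]
    --> (0 : R).
Proof.
pose f n z : R := n%:R * phi (b n) / b n * expR (- (z ^+ 2 / (2 * a n))).
pose X n z : R := n%:R * (1 - Phi (norming (b n) z)).
(* The unreduced products are the form that [expansionM] produces. *)
have exf : expansion a 3 f (fun=> 1 * 1) (fun z => 1 * 1 + 1 * (- (z ^+ 2 / 2))).
  apply: (@expansionW _ a (0 + 2) 3) => //.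
  apply: (expansionM (C := 1)) => //.
  - exact: expansion_cst (rate_level_density hb).
  - exact: expansion_gauss.
  - by move=> z; rewrite normr1.
  - by move=> z; rewrite normr1.
  - by move=> z; rewrite normr1 expr0 mulr1.
  - move=> z; rewrite normrN ger0_norm ?divr_ge0 ?sqr_ge0//.
    by have := sqr_ge0 z; nra.
have := @tail_expansion _ a f _ _ X (fun z => expR (- z)) (fun z => - s z) (fun=> 0) y exf.
have -> : (fun n => a n * (X n y - expR (- y)) - - s y - 0) =
    (fun n => a n * (n%:R * (1 - Phi (norming (b n) y)) - expR (- y)) + s y).
  by apply/funext => n; rewrite opprK subr0.
apply.
- near=> n => z.
  have b0 : 0 < b n by near: n; exact: (cvgry_gt cvg_b).
  have d := has_derive_norming (b n) z.
  apply: has_derive_eq; first by rewrite /X; solve_derive; exact: d.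
  cbv beta; rewrite phi_norming ?gt_eqF// /f /a.
  by field; rewrite gt_eqF.
- by move=> z; apply: has_derive_eq; [solve_derive|cbv beta; ring].
- move=> z; apply: has_derive_eq; first by rewrite /s; solve_derive.
  by cbv beta; field.
- near=> n.
  have b0 : 0 < b n by near: n; exact: (cvgry_gt cvg_b).
  apply: cvg_to_eq.
    apply: cvgD; last by apply: cvgN; apply: cvgN; exact: cvg_s.
    apply: cvgM; first exact: cvg_cst.
    apply: cvgD; last by apply: cvgN; exact: cvg_expRN.
    apply: cvgM; first exact: cvg_cst.
    by apply: cvgB; [exact: cvg_cst|exact: cvg_Phi_norming].
  by ring.
Unshelve. all: by end_near. Qed.

Lemma rate_joint_tail x y :
  a n * (n%:R * (1 - gauss2_cdf (rho n) (norming (b n) x) (norming (b n) y))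
         - hr_exponent lambda x y) @[n --> \oo] --> - kappa alpha lambda x y.
Proof.
have l0 : lambda != 0 by rewrite gt_eqF.
pose p := slice_p b rho y; pose q := slice_q b rho.
pose A z := lambda + y / (2 * lambda) + - (2 * lambda)^-1 * z.
have AE z : A z = hr_arg lambda z y by rewrite /A /hr_arg; field.
pose p1 := hr_p1 lambda alpha y; pose q1 := hr_q1 lambda alpha.
pose c n : R := n%:R * phi (b n) / b n.
(* Chosen so that - f n z exp(-z) is the derivative of [X n]. *)
pose f n z : R := c n * Phi (p n + q n * z) * expR (- (z ^+ 2 / (2 * a n))).
pose X n z : R := n%:R * (1 - gauss2_cdf (rho n) (norming (b n) z) (norming (b n) y)).
pose C := `|p1| + `|q1| + 1.
have C1 : 1 <= C by rewrite /C; have := normr_ge0 p1; have := normr_ge0 q1; lra.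
have A1 z : `|phi (A z) * (p1 + q1 * z)| <= C * (1 + z ^+ 2).
  rewrite normrM (le_trans (ler_piMl _ (norm_phi_le1 _)))//.
  rewrite (le_trans (ler_normD _ _))// normrM.
  have zz : `|z| <= 1 + z ^+ 2.
    by have := sqr_ge0 (`|z| - 1); have := real_normK (num_real z); nra.
  have := ler_wpM2l (normr_ge0 q1) zz; rewrite /C; have := normr_ge0 p1.
  by have := sqr_ge0 z; nra.
have ex1 : expansion a (0 + 1) (fun n z => c n * Phi (p n + q n * z))
    (fun z => 1 * Phi (A z)) (fun z => 1 * Phi (A z) + 1 * (phi (A z) * (p1 + q1 * z))).
  apply: (expansionM (C := C)) => //.
  - exact: expansion_cst (rate_level_density hb).
  - apply: expansion_Phi => //; first exact: rate_slice_p.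
    exact: rate_slice_q.
  - by move=> z; rewrite normr1.
  - by move=> z; exact: norm_Phi_le1.
  - by move=> z; rewrite normr1 expr0 mulr1.
have exf : expansion a (0 + 1 + 2) f (fun z => 1 * Phi (A z) * 1)
    (fun z => (1 * Phi (A z) + 1 * (phi (A z) * (p1 + q1 * z))) * 1
              + 1 * Phi (A z) * - (z ^+ 2 / 2)).
  apply: (expansionM (C := C + 1)) => //.
  - exact: expansion_gauss.
  - by move=> z; rewrite mul1r norm_Phi_le1.
  - by move=> z; rewrite normr1.
  - move=> z; rewrite !mul1r (le_trans (ler_normD _ _))//.
    have := norm_Phi_le1 (A z); have := A1 z; have := sqr_ge0 z.
    by rewrite [(1 + z ^+ 2) ^+ _]expr1; lra.
  - move=> z; rewrite normrN ger0_norm ?divr_ge0 ?sqr_ge0//.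
    have := sqr_ge0 z; set t := z ^+ 2 => t0.
    have : (1 + t) ^+ 2 <= (C + 1) * (1 + t) ^+ 2 by rewrite ler_peMl ?sqr_ge0//; lra.
    by nra.
(* The value at infinity of the difference to be estimated; it tends to 0 by
   [rate_marginal_tail]. *)
pose l n := a n * (n%:R * (1 - Phi (norming (b n) y)) - expR (- y)) + s y.
have key : a n * (X n x - hr_exponent lambda x y) + kappa alpha lambda x y - l n
    @[n --> \oo] --> (0 : R).
  have := @tail_expansion _ a f _ _ X (fun z => hr_exponent lambda z y)
    (fun z => - kappa alpha lambda z y) l x exf.
  have -> : (fun n => a n * (X n x - hr_exponent lambda x y) - - kappa alpha lambda x y - l n) =
    (fun n => a n * (X n x - hr_exponent lambda x y) + kappa alpha lambda x y - l n).
    by apply/funext => n; rewrite opprK.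
  apply.
  - have reg := hr_regular hrho hlambda cvg_b cvg_a hlim.
    near=> n => z.
    have : [/\ 0 < b n, -1 < rho n < 1, 0 < hr_lambda (b n) (rho n),
      1 - rho n = 2 * (hr_lambda (b n) (rho n) ^+ 2 / b n ^+ 2) &
      0 < 1 - hr_lambda (b n) (rho n) ^+ 2 / b n ^+ 2] by near: n.
    move=> [b0 rho1 ln0 rw w1].
    have d := has_derive_comp (has_derive_gauss2_cdf (norming (b n) z) (norming (b n) y) rho1)
      (has_derive_norming (b n) z).
    apply: has_derive_eq; first by rewrite /X; solve_derive; exact: d.
    cbv beta; rewrite /gauss2_slice slice_arg// phi_norming ?gt_eqF// /f /c /a -/p -/q.
    by field; rewrite gt_eqF.
  - move=> z; have -> : 1 * Phi (A z) * 1 = Phi (hr_arg lambda z y) by rewrite AE; ring.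
    exact: has_derive_hr_exponent.
  - move=> z; apply: has_derive_eq; first by apply: has_deriveN; exact: has_derive_kappa.
    by rewrite AE /p1 /q1; field.
  - have reg := hr_regular hrho hlambda cvg_b cvg_a hlim.
    near=> n.
    have [b0 rho1] : 0 < b n /\ -1 < rho n < 1.
      by near: n; apply: filterS reg => n [].
    apply: cvg_to_eq.
      apply: cvgD; last by apply: cvgN; apply: cvgN; exact: cvg_kappa.
      apply: cvgM; first exact: cvg_cst.
      apply: cvgD; last by apply: cvgN; exact: cvg_hr_exponent.
      apply: cvgM; first exact: cvg_cst.
      by apply: cvgB; [exact: cvg_cst|exact: cvg_gauss2_cdf_norming].
    by rewrite /l; ring.
have -> : (fun n => a n * (n%:R * (1 - gauss2_cdf (rho n) (norming (b n) x) (norming (b n) y))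
         - hr_exponent lambda x y)) =
   (fun n => (a n * (X n x - hr_exponent lambda x y) + kappa alpha lambda x y - l n)
     + l n - kappa alpha lambda x y) by apply/funext => n; rewrite /X; ring.
rewrite -[X in _ --> X]add0r -[X in _ --> X + _](addr0 0).
apply: cvgB; last exact: cvg_cst.
by apply: cvgD; [exact: key|exact: rate_marginal_tail].
Unshelve. all: by end_near. Qed.

End tail_asymptotics.

(** Read off the pushforward rather than the slice formula, so degenerate correlations are
    included. *)
Lemma gauss2_cdf_itv (R : realType) (rho u v : R) : 0 <= gauss2_cdf rho u v <= 1.
Proof.
pose f (z : R * R) := (z.1, rho * z.1 + Num.sqrt (1 - rho ^+ 2) * z.2).
have mf : measurable_fun [set: R * R] f.
  apply: measurable_fun_pair => //; apply: measurable_funD; exact: measurable_funM.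
have mP : measurable (f @^-1` (`]-oo, u] `*` `]-oo, v])).
  by rewrite -[X in measurable X]setTI; apply: mf => //; exact: measurableX.
pose P := (normal_prob (0 : R) (1 : R) \x normal_prob (0 : R) (1 : R))%E.
have P0 : (0 <= P (f @^-1` (`]-oo, u] `*` `]-oo, v])))%E by exact: measure_ge0.
have P1 : (P (f @^-1` (`]-oo, u] `*` `]-oo, v])) <= 1)%E by exact: probability_le1.
rewrite /gauss2_cdf fine_ge0//= -lee_fin fineK//.
by rewrite ge0_fin_numE// (le_lt_trans P1)// ltry.
Qed.

Theorem theorem2p1 (R : realType) (b rho : nat -> R) (lambda alpha : R)
    (hb : forall n : nat, (3 <= n)%N -> n%:R * (1 - Phi (b n)) = 1)
    (hrho : forall n : nat, -1 <= rho n <= 1)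
    (hlambda : 0 < lambda)
    (hlim : b n ^+ 2 * (lambda - hr_lambda (b n) (rho n)) @[n --> \oo] --> alpha)
    (x y : R) :
  b n ^+ 2 * (gauss2_cdf (rho n) (norming (b n) x) (norming (b n) y) ^+ n
              - husler_reiss lambda x y) @[n --> \oo]
    --> kappa alpha lambda x y * husler_reiss lambda x y.
Proof.
have cvg_a := cvg_level_sqr hb.
pose F n := gauss2_cdf (rho n) (norming (b n) x) (norming (b n) y).
pose T n : R := n%:R * (1 - F n).
have rT := rate_joint_tail hb hrho hlambda hlim (x := x) (y := y).
(* Delta method for exp(-t) at the exponent: the rate - [kappa] is multiplied by - H. *)
have dT : has_derive (fun t => expR (- t)) (hr_exponent lambda x y)
    (- husler_reiss lambda x y).
  by rewrite husler_reissE; apply: has_derive_eq; [solve_derive|cbv beta; ring].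
have r1 := rate_delta cvg_a rT dT; rewrite mulrNN mulrC -husler_reissE in r1.
(* |F^n - exp(-T)| <= n |F - exp(-(1 - F))| <= n (1 - F)^2 = T^2 / n, where T converges and b^2 / n
   tends to 0. *)
have r2 : b n ^+ 2 * (F n ^+ n - expR (- T n)) @[n --> \oo] --> (0 : R).
  have T2 : b n ^+ 2 / n%:R * (T n * T n) @[n --> \oo] --> (0 : R).
    rewrite -[X in _ --> X](mul0r (hr_exponent lambda x y * hr_exponent lambda x y)).
    have cT := rate_cvg cvg_a rT.
    by apply: cvgM; [exact: cvg_level_sqr_div|exact: cvgM].
  apply: norm_cvg0.
  apply: (@squeeze_cvgr _ _ _ _ (fun=> 0) (fun n => b n ^+ 2 / n%:R * (T n * T n))) => //.
  - near=> n.
    have n3 : (3 <= n)%N by near: n; exact: nbhs_infty_ge.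
    have n0 : 0 < n%:R :> R by rewrite ltr0n (leq_trans _ n3).
    have /andP[F0 F1] := gauss2_cdf_itv (rho n) (norming (b n) x) (norming (b n) y).
    rewrite -/(F n) in F0 F1.
    rewrite normr_ge0 normrM ger0_norm ?sqr_ge0// -mulrA ler_wpM2l ?sqr_ge0//=.
    have -> : expR (- T n) = expR (- (1 - F n)) ^+ n.
      by rewrite -expRM_natl; congr expR; rewrite /T; ring.
    have Fn0 : 0 <= 1 - F n by rewrite subr_ge0.
    rewrite (le_trans (dist_expn_le _ _ _))//.
    + by rewrite F0.
    + by rewrite expR_ge0 expR_le1 oppr_le0.
    + rewrite (_ : n%:R^-1 * _ = n%:R * (1 - F n) ^+ 2); last by rewrite /T; field; rewrite gt_eqF.
      rewrite ler_pM2l// distrC.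
      have /andP[e1 e2] := expR_taylor1 Fn0.
      by rewrite (_ : _ - F n = expR (- (1 - F n)) - 1 + (1 - F n)) ?ger0_norm//; ring.
  - exact: cvg_cst.
have -> : (fun n => b n ^+ 2 * (gauss2_cdf (rho n) (norming (b n) x) (norming (b n) y) ^+ n
              - husler_reiss lambda x y)) =
    (fun n => b n ^+ 2 * (F n ^+ n - expR (- T n)) +
              b n ^+ 2 * (expR (- T n) - husler_reiss lambda x y)).
  by apply/funext => n; rewrite /F; ring.
by rewrite -[X in _ --> X]add0r; exact: cvgD.
Unshelve. all: by end_near. Qed.
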